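(* Let $F$ be a number field with ring of integers $\mathcal{O}_F$. Let $f(x)=x^d+Ax^s+B\in\mathcal{O}_F[x]$ be irreducible over $F$, with $d>s\ge1$ and $\gcd(d,s)=1$. Let $\beta$ be a root of $f$ and let $L$ be the Galois closure of $F(\beta)/F$. Let $\mathfrak{p}$ be a prime of $\mathcal{O}_F$ with $\mathfrak{p}\nmid AB\mathcal{O}_F$. If $\mathfrak{p}$ ramifies in $\mathcal{O}_{F(\beta)}$, then $e(\mathfrak{q}/\mathfrak{p})=2$ for every prime $\mathfrak{q}$ of $\mathcal{O}_L$ lying above $\mathfrak{p}$; in particular, $\mathrm{Gal}(L/F)$, viewed as a permutation group on the roots of $f$, contains a transposition.
   Context: $e(\mathfrak{q}/\mathfrak{p})$ denotes the ramification index of $\mathfrak{q}$ over $\mathfrak{p}$. *)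

(* Defs.v *)
From HB Require Import structures.
From mathcomp Require Import all_boot all_order all_algebra all_field.
Set Implicit Arguments. Unset Strict Implicit. Unset Printing Implicit Defensive.
Import Order.TTheory GRing.Theory Num.Theory.
Local Open Scope ring_scope.

(* Number fields are modelled as subfields of an ambient number field
   L0 : fieldExtType rat (finite-dimensional over Q).  Ideals of a ring of
   integers O_K are predicates on L0. *)
Section NumberFieldIdeals.
Variable L0 : fieldExtType rat.

Definition integral (x : L0) : Prop :=
  exists p : {poly int}, p \is monic /\ root (map_poly (fun z : int => z%:~R) p) x.

Definition inO (K : {vspace L0}) (x : L0) : Prop := x \in K /\ integral x.

Definition is_ideal (K : {vspace L0}) (I : L0 -> Prop) : Prop :=
  [/\ forall x, I x -> inO K x,
      I 0,
      forall x y, I x -> I y -> I (x + y)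
    & forall a x, inO K a -> I x -> I (a * x)].

Definition is_prime_ideal (K : {vspace L0}) (P : L0 -> Prop) : Prop :=
  [/\ is_ideal K P,
      ~ P 1,
      (exists x, P x /\ x != 0)
    & forall x y, inO K x -> inO K y -> P (x * y) -> P x \/ P y].

Definition ideal_gen (K : {vspace L0}) (S : L0 -> Prop) : L0 -> Prop :=
  fun z => forall M, is_ideal K M -> (forall x, S x -> M x) -> M z.

Definition ideal_mul (K : {vspace L0}) (I J : L0 -> Prop) : L0 -> Prop :=
  ideal_gen K (fun z => exists x y, [/\ I x, J y & z = x * y]).

Definition ideal_exp (K : {vspace L0}) (I : L0 -> Prop) (e : nat) : L0 -> Prop :=
  iter e (ideal_mul K I) (inO K).

Definition lies_over (K : {vspace L0}) (q p : L0 -> Prop) : Prop :=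
  forall x, ideal_gen K p x -> q x.

Definition ram_index (K : {vspace L0}) (p q : L0 -> Prop) (e : nat) : Prop :=
  (forall x, ideal_gen K p x -> ideal_exp K q e x) /\
  ~ (forall x, ideal_gen K p x -> ideal_exp K q e.+1 x).

Definition ramifies_in (K : {vspace L0}) (p : L0 -> Prop) : Prop :=
  exists q e, [/\ is_prime_ideal K q, lies_over K q p, ram_index K p q e & (1 < e)%N].

End NumberFieldIdeals.

(* Main.v *)
Require Import Defs.
From HB Require Import structures.
From mathcomp Require Import all_boot all_order all_algebra all_fingroup all_field.
From mathcomp Require Import boolp ring.
Set Implicit Arguments. Unset Strict Implicit. Unset Printing Implicit Defensive.
Import Order.TTheory GRing.Theory Num.Theory.
Local Open Scope ring_scope.

(* Modulo a prime q of O_L above p, the root equation and r f'(r) = 0 determine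
   r^s and r^(d-s), hence r, because gcd(d, s) = 1: the reduction of f has at most
   one multiple root.  It is exactly double, and 2 is not in q, since it forces
   d, s and d - s to be units at q.  An element of the inertia group I fixes the
   residues of all roots, so it is trivial or the transposition of the two roots
   that collide; in particular #|I| <= 2 and I is tame.

   The remaining input is p O_L not in q^(#|I|+1) when #|I| is not in q.  For each
   h in G \ I choose x_h with h(x_h) <> x_h mod q and put
   E(g) := \prod_h (h(x_h) - g(x_h)), which vanishes for g outside I and is a unit
   at q, constant modulo q, on I.  Expanding the product,
   \sum_g g(w) E(g) is an O_L-combination of traces, so it lies in p O_L as soon as
   w lies in all conjugates of q.  For w the I-norm of a uniformizer t of q that
   lies in all its conjugates, the sum is w times a unit at q, and w is t^#|I| up
   to a unit.

   If Q is a prime of K over p, a norm argument shows that Q is the contraction of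
   a conjugate of q, so that p in Q^2 gives p in q^2 for every q.  Hence #|I| = 2
   and e(q/p) = 2.

   Dedekind theory enters only through uniformizers: P contains a rational prime l,
   rational dependence bounds chains of ideals containing l by the degree, so P is
   finitely generated, and the determinant trick makes P principal up to units
   at P. *)

(** * Integers and ideals *)

Section IntegralElements.
Variable L0 : fieldExtType rat.
Implicit Types (x y z : L0) (K : {subfield L0}).

Lemma integralE x : integral x <-> integralOver (intr : int -> L0) x.
Proof. by split=> [[p [? ?]]|[p ? ?]]; exists p. Qed.

Lemma integral_root_monic_poly (g : {poly L0}) x :
  g \is monic -> root g x -> (forall i, integral g`_i) -> integral x.
Proof.
move=> mong gx intg; apply/integralE.
apply: (integral_root_monic mong gx); apply/integral_poly => i.
exact/integralE.
Qed.

Lemma integralD x y : integral x -> integral y -> integral (x + y).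
Proof. by rewrite !integralE; apply: integral_add. Qed.
Lemma integralM x y : integral x -> integral y -> integral (x * y).
Proof. by rewrite !integralE; apply: integral_mul. Qed.
Lemma integralN x : integral x -> integral (- x).
Proof. by rewrite !integralE; apply: integral_opp. Qed.
Lemma integral_int (m : int) : integral (m%:~R : L0).
Proof. by rewrite integralE; apply: (integral_id intr). Qed.

Lemma integral_nat (m : nat) : integral (m%:R : L0).
Proof. exact: (integral_int m%:Z). Qed.

Lemma integral_coef_prod (I : Type) (r : seq I) (Pr : pred I)
    (E : I -> {poly L0}) :
  (forall i, Pr i -> forall k, integral (E i)`_k) ->
  forall k, integral (\prod_(i <- r | Pr i) E i)`_k.
Proof.
move=> intE; apply: (big_ind (fun g : {poly L0} => forall k, integral g`_k)).
- by move=> k; rewrite coef1; apply: integral_nat.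
- move=> g h ig ih k; rewrite coefM.
  apply: (big_ind (@integral L0)); first exact: (integral_int 0).
    exact: integralD.
  by move=> i _; apply: integralM.
- by move=> i Pi; apply: intE.
Qed.

Lemma integral_coef_det n (M : 'M[{poly L0}]_n) :
  (forall i j k, integral (M i j)`_k) -> forall k, integral (\det M)`_k.
Proof.
move=> intM; rewrite /determinant.
apply: (big_ind (fun g : {poly L0} => forall k, integral g`_k)).
- by move=> k; rewrite coef0; apply: (integral_int 0).
- by move=> g h ig ih k; rewrite coefD; apply: integralD.
- move=> s _ k; rewrite mulr_sign; case: (perm.odd_perm s).
    by rewrite coefN; apply/integralN/integral_coef_prod.
  exact: integral_coef_prod.
Qed.

(** The determinant trick: [x] is an eigenvalue of [C], hence a root of its characteristic
    polynomial, which is monic with integral coefficients; integrality is transitive. *)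
Lemma integral_of_stable n (C : 'M[L0]_n) (v : 'rV[L0]_n) x :
  v != 0 -> (forall i j, integral (C i j)) -> v *m C = x *: v -> integral x.
Proof.
move=> nz_v intC vC.
have rC : root (char_poly C) x.
  by rewrite -eigenvalue_root_char; apply/eigenvalueP; exists v.
apply: (integral_root_monic_poly (char_poly_monic C) rC).
apply: integral_coef_det => i j k; rewrite !mxE coefB coefMn coefX coefC.
apply: integralD; last by apply/integralN; case: ifP => _ //; exact: (integral_int 0).
by rewrite -mulrnA; apply: integral_nat.
Qed.

Section InO.
Variable K : {subfield L0}.
Notation O := (inO K).

Lemma inOD x y : O x -> O y -> O (x + y).
Proof. by move=> [? ?] [? ?]; split; [rewrite rpredD | apply: integralD]. Qed.
Lemma inOM x y : O x -> O y -> O (x * y).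
Proof. by move=> [? ?] [? ?]; split; [rewrite rpredM | apply: integralM]. Qed.
Lemma inON x : O x -> O (- x).
Proof. by move=> [? ?]; split; [rewrite rpredN | apply: integralN]. Qed.
Lemma inOB x y : O x -> O y -> O (x - y).
Proof. by move=> ? ?; apply/inOD/inON. Qed.
Lemma inO_int (m : int) : O m%:~R.
Proof. by split; [rewrite rpred_int | apply: integral_int]. Qed.
Lemma inO_nat (m : nat) : O m%:R.
Proof. by rewrite -[m%:R]/(m%:Z%:~R); apply: inO_int. Qed.
Lemma inO0 : O 0. Proof. exact: (inO_nat 0). Qed.
Lemma inO1 : O 1. Proof. exact: (inO_nat 1). Qed.
Lemma inOX x n : O x -> O (x ^+ n).
Proof.
by move=> Ox; elim: n => [|n IHn]; rewrite ?expr0 ?exprS; [apply: inO1|apply: inOM].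
Qed.
Lemma inO_sum (I : Type) (r : seq I) (Pr : pred I) (E : I -> L0) :
  (forall i, Pr i -> O (E i)) -> O (\sum_(i <- r | Pr i) E i).
Proof. by apply: big_ind; [apply: inO0 | apply: inOD]. Qed.
Lemma inO_prod (I : Type) (r : seq I) (Pr : pred I) (E : I -> L0) :
  (forall i, Pr i -> O (E i)) -> O (\prod_(i <- r | Pr i) E i).
Proof. by apply: big_ind; [apply: inO1 | apply: inOM]. Qed.

Local Notation intev g x := (map_poly intr g).[x].

Lemma inO_horner (g : {poly int}) x : O x -> O (intev g x).
Proof.
move=> Ox; elim/poly_ind: g => [|g c IHg]; first by rewrite rmorph0 horner0; apply: inO0.
rewrite rmorphD rmorphM /= map_polyX map_polyC /= hornerMXaddC.
by apply: inOD; [apply: inOM | apply: inO_int].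
Qed.

Lemma intpoly_hornerMXaddC (g : {poly int}) (c : int) x :
  intev (g * 'X + c%:P) x = (intev g x) * x + c%:~R.
Proof. by rewrite rmorphD rmorphM /= map_polyX map_polyC /= hornerMXaddC. Qed.

(** In an integral equation of [x], a nonzero constant term is a multiple of [x]; a zero one allows
    division of the equation by [x]. *)
Lemma inO_dvd_int x : O x -> x != 0 -> exists c : int, c != 0 /\
  exists y, O y /\ c%:~R = x * y.
Proof.
move=> Ox nz_x; case: (Ox.2) => g [/monic_neq0 nz_g /rootP].
rewrite -[map_poly _ _]/(map_poly intr g).
elim/poly_ind: g nz_g => [|g c IHg]; first by rewrite eqxx.
move=> nz_g; rewrite intpoly_hornerMXaddC => gx0.
have [c0|nz_c] := eqVneq c 0.
  apply: IHg.
    by apply: contra nz_g => /eqP ->; rewrite c0 mul0r add0r.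
  by move/eqP: gx0; rewrite c0 addr0 mulf_eq0 (negPf nz_x) orbF => /eqP.
exists c; split=> //; exists (- intev g x); split; first exact/inON/inO_horner.
by apply/eqP; rewrite mulrN mulrC -addr_eq0 addrC gx0.
Qed.

Section Ideal.
Variable I : L0 -> Prop.
Hypothesis idI : is_ideal K I.
Lemma idealO x : I x -> O x. Proof. by case: idI => h _ _ _; apply: h. Qed.
Lemma ideal0 : I 0. Proof. by case: idI. Qed.
Lemma idealD x y : I x -> I y -> I (x + y).
Proof. by case: idI => _ _ h _; apply: h. Qed.
Lemma ideal_absorbl a x : O a -> I x -> I (a * x).
Proof. by case: idI => _ _ _ h; apply: h. Qed.
Lemma ideal_absorbr a x : O a -> I x -> I (x * a).
Proof. by rewrite mulrC; apply: ideal_absorbl. Qed.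
Lemma idealN x : I x -> I (- x).
Proof. by rewrite -mulN1r; apply: ideal_absorbl; apply/inON/inO1. Qed.
Lemma idealB x y : I x -> I y -> I (x - y).
Proof. by move=> Ix Iy; apply/idealD/idealN. Qed.
Lemma ideal_sum (J : Type) (r : seq J) (Pr : pred J) (E : J -> L0) :
  (forall i, Pr i -> I (E i)) -> I (\sum_(i <- r | Pr i) E i).
Proof. by apply: big_ind; [apply: ideal0 | apply: idealD]. Qed.
End Ideal.

Lemma ideal_gen_ideal (S : L0 -> Prop) : (forall x, S x -> O x) ->
  is_ideal K (ideal_gen K S).
Proof.
have idO : is_ideal K O.
  by split=> //; [exact: inO0 | exact: inOD | exact: inOM].
move=> SO; split=> [x Sx||x y Ix Iy|a x Oa Ix].
- exact: Sx.
- by move=> M idM _; apply: ideal0.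
- by move=> M idM SM; apply: (idealD idM); [apply: Ix | apply: Iy].
- by move=> M idM SM; apply: (ideal_absorbl idM) => //; apply: Ix.
Qed.

Lemma ideal_gen_sub (S : L0 -> Prop) x : S x -> ideal_gen K S x.
Proof. by move=> Sx M _; apply. Qed.

Definition principal (a : L0) : L0 -> Prop := fun x => exists2 c, O c & x = a * c.

Lemma principal_ideal a : O a -> is_ideal K (principal a).
Proof.
move=> Oa; split=> [_ [c Oc ->]||_ _ [c Oc ->] [c' Oc' ->]|b _ Ob [c Oc ->]].
- exact: inOM.
- by exists 0; rewrite ?mulr0 //; exact: inO0.
- by exists (c + c'); rewrite ?mulrDr //; exact: inOD.
- by exists (b * c); [exact: inOM | rewrite mulrCA].
Qed.

(** * Nonzero prime ideals: rational primes in them, inverses modulo them *)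

Section Prime.
Variable P : L0 -> Prop.
Hypothesis prP : is_prime_ideal K P.

Lemma prime_idealW : is_ideal K P. Proof. by case: prP. Qed.
Lemma prime_ideal1 : ~ P 1. Proof. by case: prP. Qed.
Lemma prime_idealM x y : O x -> O y -> P (x * y) -> P x \/ P y.
Proof. by case: prP => _ _ _ h; apply: h. Qed.
Lemma prime_ideal_notM x y : O x -> O y -> ~ P x -> ~ P y -> ~ P (x * y).
Proof. by move=> Ox Oy nx ny /(prime_idealM Ox Oy)[]. Qed.
Lemma prime_ideal_prod (J : Type) (r : seq J) (Pr : pred J) (E : J -> L0) :
  (forall i, Pr i -> O (E i) /\ ~ P (E i)) -> ~ P (\prod_(i <- r | Pr i) E i).
Proof.
move=> H; suff [] : O (\prod_(i <- r | Pr i) E i) /\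
   ~ P (\prod_(i <- r | Pr i) E i) by [].
apply: (big_ind (fun z => O z /\ ~ P z)) => //.
  by split; [exact: inO1 | exact: prime_ideal1].
by move=> x y [Ox nx] [Oy ny]; split; [exact: inOM | exact: prime_ideal_notM].
Qed.
Lemma prime_idealX x n : O x -> P (x ^+ n) -> P x.
Proof.
move=> Ox; apply: contraPP => nPx; elim: n => [|n IHn]; first exact: prime_ideal1.
by rewrite exprS; apply: prime_ideal_notM => //; apply: inOX.
Qed.

(** A nonzero element of [P] divides a nonzero integer, which then lies in [P]; by primality one of
    its prime factors does too. *)
Lemma prime_ideal_nat : exists l : nat, prime l /\ P l%:R.
Proof.
have [_ _ [x [Px nz_x]] _] := prP.
have [c [nz_c [y [Oy cxy]]]] := inO_dvd_int (idealO prime_idealW Px) nz_x.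
have Pc : P c%:~R by rewrite cxy; apply: (ideal_absorbr prime_idealW).
have {x y Px nz_x Oy cxy nz_c Pc} [n [n0 Pn]] : exists n : nat, (0 < n)%N /\ P n%:R.
  case: c nz_c Pc {cxy} => n nz_n Pn; first by exists n; rewrite lt0n.
  exists n.+1; split=> //; rewrite -[n.+1%:R]opprK; apply: (idealN prime_idealW).
  by move: Pn; rewrite NegzE rmorphN.
elim/ltn_ind: n n0 Pn => n IHn n0 Pn.
have [n1|n1] := leqP n 1.
  by case: prime_ideal1; move: Pn; have -> : n = 1%N by apply/eqP; rewrite eqn_leq n1.
have pr := pdiv_prime n1.
move: Pn; rewrite -{1}(divnK (pdiv_dvd n)) natrM.
case/prime_idealM; [exact: inO_nat|exact: inO_nat| |by exists (pdiv n)].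
apply: IHn; first by rewrite ltn_Pdiv // prime_gt1.
by rewrite divn_gt0 ?pdiv_gt0 // pdiv_leq.
Qed.

(** The dichotomy applied below to the coefficients of integral equations: zero or invertible modulo
    [l]. *)
Lemma prime_intP (l : nat) (c : int) : prime l ->
  (l %| c)%Z \/ exists a b : int, a%:~R * c%:~R + b%:~R * l%:R = 1 :> L0.
Proof.
move=> pr; case: (boolP (l %| c)%Z) => [|ndv]; [by left | right].
have : coprimez c l by rewrite /coprimez /gcdz eqz_nat gcdnC -/(coprime _ _) prime_coprime.
case/coprimezP => -[a b] /= e; exists a, b.
by rewrite -[l%:R]/(l%:Z%:~R) -!rmorphM -rmorphD e.
Qed.

Lemma dvdz_ideal (I : L0 -> Prop) (l : nat) (c : int) : is_ideal K I ->
  I l%:R -> (l %| c)%Z -> I c%:~R.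
Proof.
move=> idI Il /dvdzP[m ->]; rewrite rmorphM /=.
by apply: (ideal_absorbl idI) => //; apply: inO_int.
Qed.

(** Read an integral equation of [x] modulo [P]. While its constant term is divisible by [l], a
    factor [x] cancels; the first constant term prime to [l] yields the inverse. Monicity prevents
    the equation from running out. *)
Lemma prime_ideal_inv x : O x -> ~ P x -> exists2 y, O y & P (x * y - 1).
Proof.
move=> Ox nPx; have [l [prl Pl]] := prime_ideal_nat.
have idP := prime_idealW.
case: (Ox.2) => g [mong /rootP].
rewrite -[map_poly _ _]/(map_poly intr g) => gx0.
have {gx0} : P (intev g x) by rewrite gx0; apply: (ideal0 idP).
elim/poly_ind: g mong => [|g c IHg].
  by rewrite monicE lead_coef0 eq_sym oner_eq0.
have [->|nz_g] := eqVneq g 0.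
  rewrite mul0r add0r monicE lead_coefC => /eqP -> .
  by rewrite rmorph1 hornerC => /prime_ideal1.
have mg : (g * 'X + c%:P \is monic) = (g \is monic).
  rewrite !monicE lead_coefDl ?lead_coefM ?lead_coefX ?mulr1 //.
  by rewrite size_mulX // size_polyC ltnS; case: (c != 0); rewrite ?size_poly_gt0.
rewrite mg intpoly_hornerMXaddC => mong Pgx.
have Og : O (intev g x) by apply: inO_horner.
case: (prime_intP c prl) => [ldc|[a [b ab1]]].
  apply: IHg => //.
  have : P ((intev g x) * x).
    by rewrite -[_ * _](addrK c%:~R); apply: (idealB idP) => //; apply: dvdz_ideal ldc.
  by case/prime_idealM.
exists (- a%:~R * (intev g x)); first by apply/inOM => //; apply/inON/inO_int.
have -> : x * (- a%:~R * (intev g x)) - 1 =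
    - a%:~R * ((intev g x) * x + c%:~R) - b%:~R * l%:R.
  by rewrite -[X in _ - X = _]ab1; ring.
apply: (idealB idP); apply: (ideal_absorbl idP) => //; [apply/inON|]; exact: inO_int.
Qed.

End Prime.

(** Nonzero primes are maximal: an element of [Q] invertible modulo [P] would put 1 in [Q]. *)
Lemma prime_ideal_sub_eq (P Q : L0 -> Prop) : is_prime_ideal K P ->
  is_prime_ideal K Q -> (forall x, P x -> Q x) -> forall x, Q x -> P x.
Proof.
move=> prP prQ PQ x Qx; apply: contrapT => nPx.
have [y Oy /PQ Qxy] := prime_ideal_inv prP (idealO (prime_idealW prQ) Qx) nPx.
apply: (prime_ideal1 prQ); rewrite -[1](subKr (x * y)).
by apply: (idealB (prime_idealW prQ)) => //; apply: (ideal_absorbr (prime_idealW prQ)).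
Qed.

(** * Adjoining finitely many elements to an ideal; bounded chains *)

Fixpoint adjoin_ideal (B : L0 -> Prop) (s : seq L0) (y : L0) : Prop :=
  if s is x :: s' then exists2 c, O c & adjoin_ideal B s' (y - c * x) else B y.

Section Adjoin.
Variable B : L0 -> Prop.
Hypothesis idB : is_ideal K B.

Lemma adjoin_ideal_ideal s : (forall x, x \in s -> O x) ->
  is_ideal K (adjoin_ideal B s).
Proof.
elim: s => [|x s IHs] Os //=.
have {}IHs : is_ideal K (adjoin_ideal B s).
  by apply: IHs => y ys; apply: Os; rewrite inE ys orbT.
have Ox : O x by apply: Os; rewrite inE eqxx.
split=> [y [c Oc /(idealO IHs) Oy]||y z [c Oc Iy] [c' Oc' Iz]|a y Oa [c Oc Iy]].
- by rewrite -(subrK (c * x) y); apply: inOD => //; apply: inOM.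
- by exists 0; [exact: inO0 | rewrite mul0r subr0; apply: ideal0].
- exists (c + c'); first exact: inOD.
  have -> : y + z - (c + c') * x = (y - c * x) + (z - c' * x) by ring.
  exact: (idealD IHs).
- exists (a * c); first exact: inOM.
  have -> : a * y - a * c * x = a * (y - c * x) by ring.
  exact: (ideal_absorbl IHs).
Qed.

Lemma adjoin_ideal_base s y : B y -> adjoin_ideal B s y.
Proof.
by elim: s y => [|x s IHs] y By //=; exists 0; [exact: inO0 | rewrite mul0r subr0; apply: IHs].
Qed.

Lemma adjoin_ideal_mem s y : y \in s -> adjoin_ideal B s y.
Proof.
elim: s => [|x s IHs] //=; rewrite inE => /orP[/eqP <-|/IHs ys].
  exists 1; first exact: inO1.
  by rewrite mul1r subrr; apply/adjoin_ideal_base/(ideal0 idB).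
by exists 0; [exact: inO0 | rewrite mul0r subr0].
Qed.

Lemma adjoin_ideal_min (J : L0 -> Prop) s : is_ideal K J ->
  (forall x, B x -> J x) -> (forall x, x \in s -> J x) ->
  forall y, adjoin_ideal B s y -> J y.
Proof.
move=> idJ BJ; elim: s => [|x s IHs] sJ y //=; first exact: BJ.
case=> c Oc Iy; rewrite -(subrK (c * x) y); apply: (idealD idJ).
  by apply: IHs => // z zs; apply: sJ; rewrite inE zs orbT.
by apply: (ideal_absorbl idJ) => //; apply: sJ; rewrite inE eqxx.
Qed.

(** Such a list encodes a strictly increasing chain of ideals starting at [B], one step per element,
    the last element of the list being adjoined first. *)
Fixpoint ideal_chain (s : seq L0) : Prop :=
  if s is y :: s' then [/\ O y, ~ adjoin_ideal B s' y & ideal_chain s'] else True.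

Lemma ideal_chainO s : ideal_chain s -> forall x, x \in s -> O x.
Proof.
elim: s => [|y s IHs] //= [Oy _ /IHs cs] x.
by rewrite inE => /orP[/eqP ->|/cs].
Qed.

Variable l : nat.
Hypotheses (prl : prime l) (Bl : B l%:R).

(** The members of a chain are independent modulo [l]: a head coefficient invertible modulo [l]
    would put the head in the ideal of the tail, which contains [l]. Then induct on the tail. *)
Lemma ideal_chain_dvd s (m : nat -> int) : ideal_chain s ->
  principal l%:R (\sum_(i < size s) (m i)%:~R * s`_i) ->
  forall i, (i < size s)%N -> (l %| m i)%Z.
Proof.
have idl := principal_ideal (inO_nat l).
elim: s m => [|y s IHs] m //= cys; case: (cys) => Oy ny cs.
rewrite big_ord_recl /= => Il.
have Os := ideal_chainO cs.
have idBs := adjoin_ideal_ideal Os.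
have lB z : principal l%:R z -> adjoin_ideal B s z.
  by case=> c Oc ->; apply/adjoin_ideal_base/(ideal_absorbr idB).
have m0 : (l %| m 0%N)%Z.
  case: (prime_intP (m 0%N) prl) => // -[a [b ab1]]; case: ny.
  have -> : y = a%:~R * ((m 0%N)%:~R * y) + b%:~R * (l%:R * y).
    by rewrite -[LHS]mul1r -[X in X * y = _]ab1; ring.
  apply: (idealD idBs); apply: (ideal_absorbl idBs); try exact: inO_int.
    rewrite -[_ * y](addrK (\sum_(i < size s) (m i.+1)%:~R * s`_i)).
    apply: (idealB idBs); first exact: lB.
    apply: (ideal_sum idBs) => i _; apply: (ideal_absorbl idBs); first exact: inO_int.
    by apply: adjoin_ideal_mem; apply: mem_nth.
  by apply: lB; exists y.
case=> [|i] //= ilt; apply: (IHs (m \o S)) => //=.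
rewrite -[X in principal _ X](addKr ((m 0%N)%:~R * y)).
apply: (idealD idl) => //.
apply: (idealN idl); case/dvdzP: m0 => c ->; rewrite rmorphM /=.
exists (c%:~R * y); first by apply: inOM => //; apply: inO_int.
by rewrite -[(l%:Z)%:~R]/(l%:R); ring.
Qed.

(* Were the chain longer than the degree, a rational dependence between its members,
   scaled to have coprime integer coefficients, would contradict [ideal_chain_dvd]. *)
Lemma ideal_chain_size s : ideal_chain s -> (size s <= \dim {:L0})%N.
Proof.
move=> cs; rewrite leqNgt; apply/negP => big_s.
have nfree : ~~ free s.
  apply: contraL big_s; rewrite /free => /eqP <-.
  by rewrite -leqNgt dimvS // subvf.
have [k [rel_k [i0 nz_k]]] : exists k : 'I_(size s) -> rat,
    \sum_i k i *: s`_i = 0 /\ exists i, k i != 0.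
  apply: contrapT => nex; case/negP: nfree; apply/(@freeP _ _ _ (in_tuple s)).
  move=> k rel i; apply/eqP; apply: contrapT => /negP nz; apply: nex.
  by exists k; split=> //; exists i.
pose k' (i : nat) : rat := if insub i is Some j then k j else 0.
have k'E (i : 'I_(size s)) : k' i = k i.
  by rewrite /k' insubT // => ?; congr k; apply: val_inj.
(* The coefficients are packed into a polynomial, so that its primitive part clears denominators and
   common factors at once; [l] then divides a content equal to 1. *)
pose q := \poly_(i < size s) k' i.
have nz_q : q != 0.
  by apply: contra nz_k => /eqP/(congr1 (fun r : {poly rat} => r`_i0));
     rewrite coef_poly ltn_ord k'E coef0 => ->.
have [r [a nz_a Dq]] := rat_poly_scale q.
have nz_r : r != 0 by apply: contra nz_q => /eqP r0; rewrite Dq r0 rmorph0 scaler0.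
have coefq i : q`_i = a%:~R^-1 * ((zcontents r)%:~R * ((zprimitive r)`_i)%:~R).
  by rewrite Dq coefZ coef_map /= {1}[r]zpolyEprim coefZ rmorphM.
have dvd_r : forall i, (i < size s)%N -> (l %| (zprimitive r)`_i)%Z.
  apply: ideal_chain_dvd => //.
  suff -> : \sum_(i < size s) ((zprimitive r)`_i)%:~R * s`_i = 0 :> L0.
    by apply: (ideal0 (principal_ideal (inO_nat l))).
  have nz_c : a%:~R^-1 * (zcontents r)%:~R != 0 :> rat.
    by rewrite mulf_neq0 ?invr_eq0 ?intr_eq0 ?zcontents_eq0.
  apply: (scalerI nz_c); rewrite scaler0 -[RHS]rel_k scaler_sumr.
  apply: eq_bigr => i _; rewrite -k'E.
  have -> : k' i = q`_i by rewrite coef_poly ltn_ord.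
  rewrite coefq mulrA -[in RHS]scalerA; congr (_ *: _).
  by rewrite mulrzl scaler_int.
have : (l %| zcontents (zprimitive r))%Z.
  rewrite dvdz_contents; apply/polyOverP => i.
  have [/dvd_r//|le_si] := ltnP i (size s).
  suff -> : (zprimitive r)`_i = 0 by rewrite dvdz0.
  have /eqP := coefq i; rewrite coef_poly ltnNge le_si /= eq_sym mulf_eq0.
  rewrite invr_eq0 intr_eq0 (negPf nz_a) /= mulf_eq0 !intr_eq0 zcontents_eq0.
  by rewrite (negPf nz_r) => /eqP.
by rewrite zcontents_primitive nz_r dvdz1 /= => /eqP l1; move: prl; rewrite l1.
Qed.

(** The Noetherian principle, from the bound on chain lengths. It is used to generate a prime by
    finitely many elements and to find a maximal ideal. *)
Lemma ideal_chain_max (Phi : seq L0 -> Prop) : Phi [::] ->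
  exists s, [/\ ideal_chain s, Phi s &
    forall y, O y -> Phi (y :: s) -> adjoin_ideal B s y].
Proof.
move=> Phi0; apply: contrapT => nex.
suff /(_ (\dim {:L0}).+1)[s [cs _ szs]] : forall n, exists s,
    [/\ ideal_chain s, Phi s & size s = n].
  by have := ideal_chain_size cs; rewrite szs ltnn.
elim=> [|n [s [cs Ps szs]]]; first by exists [::].
apply: contrapT => nexS; apply: nex; exists s; split=> // y Oy Py.
by apply: contrapT => ny; apply: nexS; exists (y :: s); rewrite /= szs.
Qed.

End Adjoin.

End InO.
End IntegralElements.

(** * Uniformizers *)

Lemma fieldExt_natr_eq0 (L0 : fieldExtType rat) n : (n%:R == 0 :> L0) = (n == 0%N).
Proof. by rewrite -(rmorph_nat (in_alg L0)) fmorph_eq0 pnatr_eq0. Qed.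

Section Uniformizer.
Variables (L0 : fieldExtType rat) (K : {subfield L0}) (P : L0 -> Prop).
Implicit Types x y z : L0.
Hypothesis prP : is_prime_ideal K P.
Notation O := (inO K).
Let idP := prime_idealW prP.
Local Notation intev g x := (map_poly intr g).[x].

(** * A prime as an associated prime of the integers modulo [l] *)

Section ResidueChar.
Variable l : nat.
Hypotheses (prl : prime l) (Pl : P l%:R).
Notation lO := (principal K l%:R).
Let idl : is_ideal K lO := principal_ideal (inO_nat K l).
Let lOl : lO l%:R.
Proof. by exists 1; [exact: inO1 | rewrite mulr1]. Qed.
Let lOP x : lO x -> P x.
Proof. by case=> c Oc ->; apply: (ideal_absorbr idP). Qed.

Lemma prime_ideal_fg : exists2 s : seq L0, (forall x, x \in s -> P x) &
  forall y, P y -> adjoin_ideal K lO s y.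
Proof.
have [s [_ sP smax]] := ideal_chain_max idl prl lOl
  (Phi := fun s => forall x, x \in s -> P x) (fun x => fun h => match notF h with end).
exists s => // y Py; apply: smax; first exact: (idealO idP).
by move=> x; rewrite inE => /orP[/eqP ->|/sP].
Qed.

Lemma adjoin_ideal_coef (s : seq L0) y : adjoin_ideal K lO s y ->
  exists2 c : nat -> L0, (forall i, O (c i)) &
    y = \sum_(i < (size s).+1) c i * (l%:R :: s)`_i.
Proof.
elim: s y => [|x s IHs] y /=.
  by case=> c Oc ->; exists (fun=> c) => //; rewrite big_ord1 mulrC.
case=> a Oa /IHs[c Oc eqy].
(* Index 0 stays with [l], index 1 is the new generator [x], and the older generators shift by
   one. *)
exists (fun i => if i is i'.+1 then if i' is j.+1 then c j.+1 else a else c 0%N).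
  by case=> [|[|i]].
rewrite -[LHS](subrK (a * x)) eqy !big_ord_recl /= -!addrA; congr (_ + _).
by rewrite addrC.
Qed.

(** Constant terms divisible by [l] are stripped from an integral equation of [x], turning each time
    one factor [x] into a power in front. At the first constant term prime to [l], the remaining
    value is outside [P] because [x] is in [P]. *)
Lemma prime_ideal_locally_nilpotent x : P x ->
  exists h m, [/\ O h, ~ P h & lO (x ^+ m * h)].
Proof.
move=> Px; have Ox := idealO idP Px.
case: (Ox.2) => g [mong /rootP].
rewrite -[map_poly _ _]/(map_poly intr g) => gx0.
have : lO (x ^+ 0 * intev g x) by rewrite gx0 mulr0; apply: (ideal0 idl).
elim/poly_ind: g mong {gx0} 0%N => [|g c IHg].
  by rewrite monicE lead_coef0 eq_sym oner_eq0.
move=> mong m; rewrite intpoly_hornerMXaddC.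
case: (prime_intP L0 c prl) => [ldc|[a [b ab1]]] Im.
  have Il : lO (x ^+ m.+1 * intev g x).
    have -> : x ^+ m.+1 * intev g x =
       x ^+ m * (intev g x * x + c%:~R) - x ^+ m * c%:~R by rewrite exprS; ring.
    apply: (idealB idl) => //; apply: (ideal_absorbl idl); first exact: inOX.
    exact: (dvdz_ideal idl lOl).
  have [g0|nz_g] := eqVneq g 0.
    case/negP: (prime_gt1 prl); move: mong ldc; rewrite g0 mul0r add0r monicE.
    rewrite lead_coefC => /eqP ->; rewrite dvdz1 /= => /eqP ->.
    by [].
  apply: IHg Il; move: mong; rewrite !monicE lead_coefDl ?lead_coefM ?lead_coefX ?mulr1 //.
  by rewrite size_mulX // size_polyC ltnS; case: (c != 0); rewrite ?size_poly_gt0.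
have Og : O (intev g x) by apply: inO_horner.
exists (intev g x * x + c%:~R), m; split=> //.
  by apply: inOD; [apply: inOM | apply: inO_int].
move=> Ph; apply: (prime_ideal1 prP); rewrite -ab1; apply: (idealD idP).
  apply: (ideal_absorbl idP); first exact: inO_int.
  rewrite -[c%:~R](addKr (intev g x * x)); apply: (idealD idP) => //.
  by apply/(idealN idP)/(ideal_absorbl idP).
by apply: (ideal_absorbl idP) => //; apply: inO_int.
Qed.

(** For each [x] in turn, [b] is multiplied by the largest power of [x] that keeps it outside
    [l O]. *)
Lemma annihilator_exists (s : seq L0) (b : L0) : (forall x, x \in s -> O x) ->
  O b -> ~ lO b -> (forall x, x \in s -> exists m, lO (x ^+ m * b)) ->
  exists c, [/\ O c, ~ lO (c * b) & forall x, x \in s -> lO (x * (c * b))].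
Proof.
elim: s b => [|x s IHs] b Os Ob nb hb.
  by exists 1; split=> //; [exact: inO1 | rewrite mul1r].
have Ox : O x by apply: Os; rewrite inE eqxx.
have [k nk Ik] : exists2 k, ~ lO (x ^+ k * b) & lO (x ^+ k.+1 * b).
  have [m] : exists m, lO (x ^+ m * b) by apply: hb; rewrite inE eqxx.
  elim: m => [|m IHm]; first by rewrite mul1r.
  by case: (pselect (lO (x ^+ m * b))) => [/IHm|nm] // Im; exists m.
have [] := IHs (x ^+ k * b) _ _ nk.
- by move=> z zs; apply: Os; rewrite inE zs orbT.
- by apply: inOM => //; apply: inOX.
- move=> z zs; have [m Im] : exists m, lO (z ^+ m * b) by apply: hb; rewrite inE zs orbT.
  by exists m; rewrite mulrCA; apply: (ideal_absorbl idl) => //; apply: inOX.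
move=> c [Oc nc hc]; exists (c * x ^+ k); split=> [||z].
- by apply: inOM => //; apply: inOX.
- by rewrite -mulrA.
rewrite inE -mulrA => /orP[/eqP ->|/hc//].
by rewrite mulrCA [x * _]mulrA -exprS; apply: (ideal_absorbl idl).
Qed.

(** The multipliers making the finitely many generators of [P] nilpotent modulo [l] have a product
    [h] outside [P], hence outside [l O]; a multiple of [h] is then killed by all generators. *)
Lemma prime_ideal_annihilator : exists b,
  [/\ O b, ~ lO b & forall x, P x -> lO (x * b)].
Proof.
have [s sP genP] := prime_ideal_fg.
have [h [Oh nh hs]] : exists h, [/\ O h, ~ P h &
    forall x, x \in s -> exists m, lO (x ^+ m * h)].
  elim: s sP {genP} => [|x s IHs] sP.
    by exists 1; split=> //; [exact: inO1 | exact: (prime_ideal1 prP)].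
  have [z zs|h [Oh nh hs]] := IHs; first by apply: sP; rewrite inE zs orbT.
  have [|h' [m [Oh' nh' hx]]] := @prime_ideal_locally_nilpotent x.
    by apply: sP; rewrite inE eqxx.
  exists (h' * h); split; [exact: inOM | exact: (prime_ideal_notM prP) |].
  move=> z; rewrite inE => /orP[/eqP ->|/hs[m' hz]].
    by exists m; rewrite mulrA; apply: (ideal_absorbr idl).
  by exists m'; rewrite mulrCA; apply: (ideal_absorbl idl).
have [||c [Oc nc hc]] := annihilator_exists _ Oh _ hs.
- by move=> x /sP /(idealO idP).
- by move/lOP.
have Och : O (c * h) by apply: inOM.
exists (c * h); split=> // x /genP.
suff idJ : is_ideal K (fun z => O z /\ lO (z * (c * h))).
  move/(adjoin_ideal_min idJ) => H; apply: (H _ _).2 => z.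
    by move=> Iz; split; [exact: (idealO idl) | apply: (ideal_absorbr idl)].
  by move=> zs; split; [exact/(idealO idP)/sP | exact: hc].
split=> [z []||y z [Oy Iy] [Oz Iz]|a z Oa [Oz Iz]] //.
- by split; [exact: inO0 | rewrite mul0r; exact: (ideal0 idl)].
- by split; [exact: inOD | rewrite mulrDl; exact: (idealD idl)].
- by split; [exact: inOM | rewrite -mulrA; exact: (ideal_absorbl idl)].
Qed.

(** Multiplication by [x] acts on the finite generating family [l :: s] of [P], which is nonzero
    since [l] is, so the determinant trick applies. *)
Lemma prime_ideal_stabilizer x : x \in K -> (forall y, P y -> P (x * y)) -> O x.
Proof.
move=> Kx xP; split=> //.
have [s sP genP] := prime_ideal_fg.
have Pe i : (i < (size s).+1)%N -> P (l%:R :: s)`_i.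
  by case: i => [|i] //= ilt; apply/sP/mem_nth.
have /choice[c Hc] (i : 'I_(size s).+1) : exists c : nat -> L0, (forall j, O (c j)) /\
    x * (l%:R :: s)`_i = \sum_(j < (size s).+1) c j * (l%:R :: s)`_j.
  by have [c Oc e] := adjoin_ideal_coef (genP _ (xP _ (Pe i (ltn_ord i)))); exists c.
apply: (@integral_of_stable _ _ (\matrix_(j, i < (size s).+1) c i j)
          (\row_(i < (size s).+1) (l%:R :: s)`_i)).
- apply/eqP => /rowP/(_ 0); rewrite !mxE /= => /eqP.
  by rewrite fieldExt_natr_eq0; apply/negP; rewrite -lt0n prime_gt0.
- by move=> i j; rewrite mxE; case: ((Hc j).1 i).
- apply/rowP => i; rewrite !mxE (Hc i).2; apply: eq_bigr => j _.
  by rewrite !mxE mulrC.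
Qed.

End ResidueChar.

(* Since b P lies in l O while b does not, b/l is not integral, so it cannot map
   P into itself: some t in P is sent by b/l to a unit at P. *)
Lemma prime_ideal_uniformizer : exists t u, [/\ P t, O u, ~ P u &
  forall x, P x -> exists2 y, O y & u * x = t * y].
Proof.
have [l [prl Pl]] := prime_ideal_nat prP.
have nzl : l%:R != 0 :> L0 by rewrite fieldExt_natr_eq0 -lt0n prime_gt0.
have [b [Ob nb hb]] := prime_ideal_annihilator prl Pl.
have hb' x : P x -> O (b / l%:R * x).
  by case/hb => c Oc e; rewrite mulrAC [b * x]mulrC e mulrAC divff // mul1r.
apply: contrapT => nex; apply: nb.
exists (b / l%:R); last by rewrite mulrC divfK.
apply: (prime_ideal_stabilizer prl Pl).
  by rewrite rpred_div ?rpred_nat //; case: Ob.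
move=> t Pt; apply: contrapT => nu; apply: nex.
exists t, (b / l%:R * t); split=> //; first exact: hb'.
by move=> x Px; exists (b / l%:R * x); [exact: hb' | rewrite mulrAC mulrC].
Qed.

(** * Powers of ideals *)

Lemma ideal_mul_ideal (I J : L0 -> Prop) : is_ideal K I -> is_ideal K J ->
  is_ideal K (ideal_mul K I J).
Proof.
move=> idI idJ; apply: ideal_gen_ideal => _ [x [y [Ix Jy ->]]].
by apply: inOM; [exact: (idealO idI) | exact: (idealO idJ)].
Qed.

Lemma ideal_exp_ideal (I : L0 -> Prop) e : is_ideal K I ->
  is_ideal K (ideal_exp K I e).
Proof.
move=> idI; elim: e => [|e IHe]; last exact: ideal_mul_ideal.
by split=> //; [exact: inO0 | exact: inOD | exact: inOM].
Qed.

Lemma ideal_exp_anti (I : L0 -> Prop) m n : is_ideal K I -> (m <= n)%N ->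
  forall x, ideal_exp K I n x -> ideal_exp K I m x.
Proof.
move=> idI /subnK <-; elim: (n - m)%N => [|k IHk] x //.
rewrite addSn => Ix; apply: IHk; apply: Ix; first exact: ideal_exp_ideal.
move=> _ [y [z [Iy Iz ->]]]; apply: (ideal_absorbl (ideal_exp_ideal _ idI)) => //.
exact: (idealO idI).
Qed.

(** Locally at [P] the e-th power of [P] is contained in the ideal of [t ^+ e], with [u ^+ e] as
    common denominator. This is how membership in a power of [P] is refuted. *)
Lemma ideal_exp_uniformizer t u e : O t -> O u ->
  (forall x, P x -> exists2 y, O y & u * x = t * y) ->
  forall x, ideal_exp K P e x -> exists2 y, O y & u ^+ e * x = t ^+ e * y.
Proof.
move=> Ot Ou Hu; elim: e => [|e IHe] x; first by exists x; rewrite ?expr0.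
move=> Ix; suff [] : O x /\ exists2 y, O y & u ^+ e.+1 * x = t ^+ e.+1 * y by [].
apply: (Ix (fun x => O x /\ exists2 y, O y & u ^+ e.+1 * x = t ^+ e.+1 * y)).
  split=> [y []||y z [Oy [a Oa ea]] [Oz [b Ob eb]]|c y Oc [Oy [a Oa ea]]] //.
  - by split; [exact: inO0 | exists 0; [exact: inO0 | rewrite !mulr0]].
  - split; first exact: inOD.
    by exists (a + b); [exact: inOD | rewrite !mulrDr ea eb].
  - split; first exact: inOM.
    by exists (c * a); [exact: inOM | rewrite mulrCA ea mulrCA].
move=> _ [y [z [Py Iz ->]]].
have Oy := idealO idP Py.
have Oz := idealO (ideal_exp_ideal e idP) Iz.
split; first exact: inOM.
have [a Oa ea] := Hu _ Py; have [b Ob eb] := IHe _ Iz.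
by exists (a * b); [exact: inOM | rewrite !exprS mulrACA ea eb mulrACA].
Qed.

End Uniformizer.

(** * Primes above a prime, inertia *)

Section LyingOver.
Variables (L0 : fieldExtType rat) (F L : {subfield L0}).
Hypothesis sFL : (F <= L)%VS.
Implicit Types x y z : L0.

Lemma inOS x : inO F x -> inO L x.
Proof. by case=> Fx intx; split=> //; apply: (subvP sFL). Qed.

Lemma contraction_prime (q : L0 -> Prop) : is_prime_ideal L q ->
  is_prime_ideal F (fun x => x \in F /\ q x).
Proof.
move=> prq; have idq := prime_idealW prq; split.
- split=> [x [Fx qx]||x y [Fx qx] [Fy qy]|a x Oa [Fx qx]].
  + by split=> //; case: (idealO idq qx).
  + by split; [rewrite mem0v | exact: (ideal0 idq)].
  + by split; [rewrite rpredD | exact: (idealD idq)].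
  + by split; [rewrite rpredM //; case: Oa | apply: (ideal_absorbl idq) => //; exact: inOS].
- by case=> _ /(prime_ideal1 prq).
- have [l [prl ql]] := prime_ideal_nat prq.
  exists l%:R; split; first by rewrite rpred_nat.
  by rewrite fieldExt_natr_eq0 -lt0n prime_gt0.
- move=> x y Ox Oy [_ /(prime_idealM prq (inOS Ox) (inOS Oy))].
  by case: Ox Oy => Fx _ [Fy _] [qx|qy]; [left | right].
Qed.

Lemma lies_over_sub (p q : L0 -> Prop) x : lies_over L q p -> p x -> q x.
Proof. by move=> qp px; apply: qp; apply: ideal_gen_sub. Qed.

Variable p : L0 -> Prop.
Hypothesis prp : is_prime_ideal F p.
Let idp := prime_idealW prp.

Lemma extension_ideal : is_ideal L (ideal_gen L p).
Proof. by apply: ideal_gen_ideal => x px; apply/inOS/(idealO idp). Qed.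

(** The contraction of [q] is a prime containing [p], and [p] is maximal. *)
Lemma contraction_over (q : L0 -> Prop) x : is_prime_ideal L q ->
  lies_over L q p -> x \in F -> q x -> p x.
Proof.
move=> prq qp Fx qx.
apply: (prime_ideal_sub_eq prp (contraction_prime prq)) => // y py.
by split; [case: (idealO idp py) | exact: lies_over_sub py].
Qed.

(** If 1 were in the extension, then [u = t * y] with [y] integral over the base; [y = u / t] lies
    in [F], so [u] would lie in [p]. *)
Lemma extension_proper : ~ ideal_gen L p 1.
Proof.
have [t [u [pt Ou npu Hu]]] := prime_ideal_uniformizer prp.
have Ot := idealO idp pt.
pose M z := inO L z /\ exists2 y, inO L y & u * z = t * y.
have idM : is_ideal L M.
  split=> [z []||x y [Ox [a Oa ea]] [Oy [b Ob eb]]|c y Oc [Oy [a Oa ea]]] //.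
  - by split; [exact: inO0 | exists 0; [exact: inO0 | rewrite !mulr0]].
  - split; first exact: inOD.
    by exists (a + b); [exact: inOD | rewrite !mulrDr ea eb].
  - split; first exact: inOM.
    by exists (c * a); [exact: inOM | rewrite mulrCA ea mulrCA].
move=> /(_ M idM)[z pz|_ [y Oy]].
  have [y Oy e] := Hu _ pz.
  by split; [exact/inOS/(idealO idp) | exists y => //; exact: inOS].
rewrite mulr1 => uE; apply: (npu); rewrite uE; apply: (ideal_absorbr idp) => //.
split; last by case: Oy.
have nzt : t != 0.
  apply/eqP => t0; apply: (prime_ideal1 prp).
  have [v Ov] := prime_ideal_inv prp Ou npu.
  by rewrite uE t0 mul0r mul0r add0r => /(idealN idp); rewrite opprK.
have -> : y = u / t by rewrite uE mulrC mulKf.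
by case: Ou => Fu _; case: Ot => Ft _; rewrite rpred_div.
Qed.

(** A chain that is maximal among those generating a proper ideal over the extension of [p]
    generates a maximal, hence prime, ideal. *)
Lemma prime_over_exists : exists q, is_prime_ideal L q /\ lies_over L q p.
Proof.
have [l [prl pl]] := prime_ideal_nat prp.
have idB := extension_ideal.
have Bl : ideal_gen L p l%:R by exact: ideal_gen_sub.
have [s [cs nPhi smax]] := ideal_chain_max idB prl Bl
  (Phi := fun s => ~ adjoin_ideal L (ideal_gen L p) s 1) extension_proper.
have ids := adjoin_ideal_ideal idB (ideal_chainO cs).
exists (adjoin_ideal L (ideal_gen L p) s); split; last first.
  by move=> x; apply: adjoin_ideal_base.
split=> //.
  exists l%:R; split; first exact: adjoin_ideal_base.
  by rewrite fieldExt_natr_eq0 -lt0n prime_gt0.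
move=> x y Ox Oy Ixy; case: (pselect (adjoin_ideal L (ideal_gen L p) s x)); first by left.
move=> nx; right; apply: contrapT => ny; apply: nx; apply: smax => //= -[c Oc Ic].
apply: ny; have -> : y = y * (1 - c * x) + c * (x * y) by ring.
by apply: (idealD ids); apply: (ideal_absorbl ids).
Qed.

End LyingOver.

(** * A finite group acting on [L] with fixed field [F] *)

Section GaloisAction.
Variables (L0 : fieldExtType rat) (F L : {subfield L0}).
Hypothesis sFL : (F <= L)%VS.
Variables (gT : finGroupType) (G : {group gT}) (act : gT -> 'End(L0)).
Hypothesis act_kAut : forall g, g \in G -> kAut F L (act g).
Hypothesis actM : forall g h x, g \in G -> h \in G -> x \in L ->
  act (g * h)%g x = act h (act g x).
Hypothesis act_fixed : forall x, x \in L ->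
  (forall g, g \in G -> act g x = x) -> x \in F.
Implicit Types (x y z : L0) (g h : gT).

Lemma act_kHom g : g \in G -> kHom F L (act g).
Proof. by move=> /act_kAut/kHom_kAut_sub. Qed.
Lemma act_in g x : g \in G -> x \in L -> act g x \in L.
Proof.
by move=> /act_kAut; rewrite kAutE => /andP[_ /subvP s] Lx; apply/s/memv_img.
Qed.
Lemma act_mul g x y : g \in G -> x \in L -> y \in L ->
  act g (x * y) = act g x * act g y.
Proof. by move=> /act_kHom/kHomP_tmp[_ H] Lx Ly; apply: H. Qed.
Lemma act_id g x : g \in G -> x \in F -> act g x = x.
Proof. by move=> /act_kHom/kHomP_tmp[H _]; apply: H. Qed.
Lemma act_one g : g \in G -> act g 1 = 1.
Proof. by move=> Gg; rewrite act_id ?mem1v. Qed.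
Lemma act_prod g (J : Type) (r : seq J) (Pr : pred J) (E : J -> L0) :
  g \in G -> (forall i, Pr i -> E i \in L) ->
  act g (\prod_(i <- r | Pr i) E i) = \prod_(i <- r | Pr i) act g (E i).
Proof.
move=> Gg LE; elim: r => [|i r IHr]; first by rewrite !big_nil act_one.
rewrite !big_cons; case: ifP => // Pi.
by rewrite act_mul ?LE ?IHr // rpred_prod.
Qed.

Lemma act_inj g x y : g \in G -> x \in L -> y \in L -> act g x = act g y -> x = y.
Proof.
move=> Gg Lx Ly e; apply/eqP; rewrite -subr_eq0; apply/eqP; apply: contrapT => /eqP nz.
have Lxy : x - y \in L by rewrite rpredB.
have := act_one Gg; rewrite -(divff nz) act_mul ?rpredV // linearB /= e subrr mul0r.
by rewrite divff // => /eqP; rewrite eq_sym oner_eq0.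
Qed.

Lemma act_group1 x : x \in L -> act 1%g x = x.
Proof.
move=> Lx; apply: (@act_inj 1%g); rewrite ?group1 ?act_in //.
by rewrite -actM ?group1 // mulg1.
Qed.
Lemma act_invK g x : g \in G -> x \in L -> act g^-1%g (act g x) = x.
Proof. by move=> Gg Lx; rewrite -actM ?groupV // mulgV act_group1. Qed.
Lemma act_Kinv g x : g \in G -> x \in L -> act g (act g^-1%g x) = x.
Proof. by move=> Gg Lx; rewrite -actM ?groupV // mulVg act_group1. Qed.

Lemma act_O g x : g \in G -> inO L x -> inO L (act g x).
Proof.
move=> Gg [Lx [r [monr rx]]]; split; first exact: act_in.
exists r; split=> //; apply: (kHom_root_id sFL (act_kHom Gg)) => //.
by apply/polyOverP => i; rewrite coef_map /= rpred_int.
Qed.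

Lemma trace_in x : x \in L -> \sum_(g in G) act g x \in F.
Proof.
move=> Lx; apply: act_fixed => [|h Gh]; first by apply: rpred_sum => g Gg; exact: act_in.
rewrite linear_sum /= [RHS](reindex_inj (mulIg h)) /=.
apply: eq_big => g; first by rewrite groupMr.
by move=> Gg; rewrite actM.
Qed.

Lemma norm_in x : x \in L -> \prod_(g in G) act g x \in F.
Proof.
move=> Lx; apply: act_fixed => [|h Gh]; first by apply: rpred_prod => g Gg; exact: act_in.
rewrite act_prod //; last by move=> g Gg; exact: act_in.
rewrite [RHS](reindex_inj (mulIg h)) /=.
apply: eq_big => g; first by rewrite groupMr.
by move=> Gg; rewrite actM.
Qed.

Variables p q : L0 -> Prop.
Hypotheses (prp : is_prime_ideal F p) (prq : is_prime_ideal L q).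
Hypothesis qp : lies_over L q p.
Let idp := prime_idealW prp.
Let idq := prime_idealW prq.
Notation O := (inO L).

(** The conjugate of [q] by the inverse of [g]. The conjunct [x \in L] is there because nothing is
    known of [act g] outside [L]. *)
Lemma conj_prime g : g \in G -> is_prime_ideal L (fun x => x \in L /\ q (act g x)).
Proof.
move=> Gg; split.
- split=> [x [Lx qx]||x y [Lx qx] [Ly qy]|a x Oa [Lx qx]].
  + by rewrite -(act_invK Gg Lx); apply: act_O; rewrite ?groupV //; apply: (idealO idq).
  + by rewrite mem0v linear0; split=> //; exact: (ideal0 idq).
  + by rewrite rpredD // linearD; split=> //; exact: (idealD idq).
  + case: (Oa) => La _; rewrite rpredM // act_mul //; split=> //.
    by apply: (ideal_absorbl idq) => //; exact: act_O.
- by rewrite act_one // => -[_ /(prime_ideal1 prq)].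
- have [l [prl ql]] := prime_ideal_nat prq.
  exists l%:R; rewrite act_id ?rpred_nat //; split=> //.
  by rewrite fieldExt_natr_eq0 -lt0n prime_gt0.
- move=> x y Ox Oy; case: (Ox) (Oy) => Lx _ [Ly _]; rewrite act_mul // => -[_].
  by case/(prime_idealM prq (act_O Gg Ox) (act_O Gg Oy)) => ?; [left | right].
Qed.

(** Otherwise each [g] has some [y g] outside [Q] that it sends into [q]. The product [Y] is outside
    [Q], with all conjugates in [q]. Inverting it modulo [Q] gives [x] in [Q] with no conjugate in
    [q]; its norm is outside [q], yet lies in [Q] and in [F], hence in [p]. *)
Lemma prime_above_conj (K : {subfield L0}) (Q : L0 -> Prop) :
  (F <= K)%VS -> (K <= L)%VS -> is_prime_ideal K Q -> lies_over K Q p ->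
  exists2 g, g \in G & forall x, Q x -> q (act g x).
Proof.
move=> sFK sKL prQ Qp; have idQ := prime_idealW prQ.
apply: contrapT => nex.
have /choice[y Hy] g : exists y, g \in G -> [/\ inO K y, q (act g y) & ~ Q y].
  case: (boolP (g \in G)) => [Gg|_]; last by exists 0.
  apply: contrapT => nexy; apply: nex; exists g => // x Qx.
  have prg := contraction_prime sKL (conj_prime Gg).
  case: (prime_ideal_sub_eq prg prQ _ Qx) => [z [Kz [Lz qz]]|_ []] //.
  apply: contrapT => nQz; apply: nexy; exists z => _; split=> //.
  by apply: (idealO (prime_idealW prg)).
pose Y := \prod_(g in G) y g.
have OyL g : g \in G -> O (y g) by move=> /Hy[Oy _ _]; apply: (inOS sKL).
have OY : inO K Y by apply: inO_prod => g /Hy[].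
have qY g : g \in G -> q (act g Y).
  move=> Gg; rewrite /Y act_prod //; last by move=> h /OyL[].
  rewrite (bigD1 g) //=; case: (Hy g Gg) => _ qy _.
  apply: (ideal_absorbr idq) => //; apply: inO_prod => h /andP[Gh _].
  by apply: act_O => //; apply: OyL.
have nQY : ~ Q Y by apply: (prime_ideal_prod prQ) => g /Hy[].
have [v Ov Qx] := prime_ideal_inv prQ OY nQY.
set x := Y * v - 1 in Qx.
have [Kx _] := idealO idQ Qx.
have Ox : O x by apply/(inOS sKL)/(idealO idQ).
have LY : Y \in L by case: (inOS sKL OY).
have Lv : v \in L by case: (inOS sKL Ov).
have nqx g : g \in G -> ~ q (act g x).
  move=> Gg; rewrite /x linearB /= act_mul // act_one // => qx.
  apply: (prime_ideal1 prq); rewrite -[1](subKr (act g Y * act g v)).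
  apply: (idealB idq) => //; apply: (ideal_absorbr idq); last exact: qY.
  by apply: act_O => //; apply: (inOS sKL).
pose N := \prod_(g in G) act g x.
have nqN : ~ q N.
  by apply: (prime_ideal_prod prq) => g Gg; split; [apply: act_O | apply: nqx].
have FN : N \in F by apply: norm_in; case: Ox.
apply: nqN; apply: (lies_over_sub qp); apply: (contraction_over sFK prp prQ Qp) => //.
have NE : N = x * \prod_(g in G | g != 1%g) act g x.
  by rewrite /N (bigD1 1%g) //= act_group1 //; case: Ox.
rewrite NE; apply: (ideal_absorbr idQ) => //.
(* The other conjugates of [x] may leave [K], but their product is [N / x], which is in [K] and
   integral. *)
have nzx : x != 0.
  by apply/eqP => x0; apply: (nqx 1%g); rewrite ?group1 // x0 linear0; apply: (ideal0 idq).
split.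
  have -> : \prod_(g in G | g != 1%g) act g x = N / x by rewrite NE mulrC mulKf.
  by rewrite rpred_div //; apply: (subvP sFK).
suff [] : O (\prod_(g in G | g != 1%g) act g x) by [].
by apply: inO_prod => g /andP[Gg _]; apply: act_O.
Qed.

Lemma ideal_exp_act (K : {subfield L0}) (Q : L0 -> Prop) g e : (K <= L)%VS ->
  is_ideal K Q -> g \in G -> (forall x, Q x -> q (act g x)) ->
  forall x, ideal_exp K Q e x -> ideal_exp L q e (act g x).
Proof.
move=> sKL idQ Gg Qq; elim: e => [|e IHe] x; first by move=> Ox; apply/act_O/(inOS sKL).
have idqe := ideal_exp_ideal e.+1 idq.
move=> Ix; suff [] : inO K x /\ ideal_exp L q e.+1 (act g x) by [].
apply: (Ix (fun x => inO K x /\ ideal_exp L q e.+1 (act g x))).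
  split=> [y []||y z [Oy Iy] [Oz Iz]|a y Oa [Oy Iy]] //.
  - by split; [exact: inO0 | rewrite linear0; exact: (ideal0 idqe)].
  - by split; [exact: inOD | rewrite linearD; exact: (idealD idqe)].
  - split; first exact: inOM.
    rewrite act_mul //; try by [case: (inOS sKL Oa) | case: (inOS sKL Oy)].
    by apply: (ideal_absorbl idqe) => //; apply/act_O/(inOS sKL).
move=> _ [y [z [Qy Iz ->]]].
have Oy := idealO idQ Qy; have Oz := idealO (ideal_exp_ideal e idQ) Iz.
split; first exact: inOM.
rewrite act_mul //; try by [case: (inOS sKL Oz) | case: (inOS sKL Oy)].
by apply: ideal_gen_sub; exists (act g y), (act g z); split=> //; [exact: Qq | exact: IHe].
Qed.

(** An element [g] carrying [Q] into [q] carries powers of [Q] into powers of [q] and fixes [p]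
    pointwise; thus ramification at one [Q] is felt at every [q]. *)
Lemma ramified_above (K : {subfield L0}) (Q : L0 -> Prop) e :
  (F <= K)%VS -> (K <= L)%VS -> is_prime_ideal K Q -> lies_over K Q p ->
  (forall x, ideal_gen K p x -> ideal_exp K Q e x) ->
  forall x, ideal_gen L p x -> ideal_exp L q e x.
Proof.
move=> sFK sKL prQ Qp pQe x px; apply: px; first exact: ideal_exp_ideal.
have [g Gg Hg] := prime_above_conj sFK sKL prQ Qp => y py.
rewrite -(act_id Gg (idealO idp py).1).
apply: (ideal_exp_act sKL (prime_idealW prQ) Gg Hg).
by apply: pQe; apply: ideal_gen_sub.
Qed.

(** * The inertia group and the tame bound *)

Definition inertia : {set gT} :=
  [set g in G | `[< forall x, O x -> q (act g x - x) >]].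

Lemma inertiaP g : reflect (g \in G /\ forall x, O x -> q (act g x - x)) (g \in inertia).
Proof.
rewrite inE; apply: (iffP andP) => [[Gg /asboolP]|[Gg H]]; first by [].
by split=> //; apply/asboolP.
Qed.

Lemma inertia_subset g : g \in inertia -> g \in G. Proof. by case/inertiaP. Qed.

Lemma inertia_group_set : group_set inertia.
Proof.
apply/group_setP; split=> [|g h /inertiaP[Gg Hg] /inertiaP[Gh Hh]].
  apply/inertiaP; split=> // x [Lx _]; rewrite act_group1 // subrr; exact: (ideal0 idq).
apply/inertiaP; split=> [|x Ox]; first exact: groupM.
case: (Ox) => Lx _; rewrite actM //.
have -> : act h (act g x) - x = (act h (act g x) - act g x) + (act g x - x) by ring.
by apply: (idealD idq); [apply/Hh/act_O | apply: Hg].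
Qed.
Canonical inertia_group := Group inertia_group_set.

Lemma prod_congr (J : Type) (r : seq J) (Pr : pred J) (a b : J -> L0) :
  (forall i, Pr i -> [/\ O (a i), O (b i) & q (a i - b i)]) ->
  q (\prod_(i <- r | Pr i) a i - \prod_(i <- r | Pr i) b i).
Proof.
move=> H; elim: r => [|i r IHr]; first by rewrite !big_nil subrr; exact: (ideal0 idq).
rewrite !big_cons; case: ifP => // Pi; have [Oa Ob qab] := H i Pi.
set A := \prod_(j <- r | Pr j) a j in IHr *; set C := \prod_(j <- r | Pr j) b j in IHr *.
have -> : a i * A - b i * C = a i * (A - C) + (a i - b i) * C by ring.
apply: (idealD idq); [exact: (ideal_absorbl idq) | apply: (ideal_absorbr idq) => //].
by apply: inO_prod => j /H[].
Qed.

(** If [g] maps [q] into itself, take 1. If not, maximality gives an element outside [q] that [g]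
    sends into [q]. *)
Lemma decomposition_separator g : g \in G -> exists z,
  [/\ O z, ~ q z & forall y, q y -> q (act g (z * y))].
Proof.
move=> Gg; case: (pselect (forall y, q y -> q (act g y))) => [H|nH].
  by exists 1; split; [exact: inO1 | exact: (prime_ideal1 prq) | move=> y; rewrite mul1r; apply: H].
have prg := conj_prime Gg.
have [z [[Lz qz] nqz]] : exists z, (z \in L /\ q (act g z)) /\ ~ q z.
  apply: contrapT => nex; apply: nH => y qy.
  have [] // := prime_ideal_sub_eq prg prq _ qy.
  by move=> z zP; apply: contrapT => nqz; apply: nex; exists z.
exists z; split=> //; first exact: (idealO (prime_idealW prg)).
move=> y /(idealO idq) Oy; rewrite act_mul //; last by case: Oy.
by apply: (ideal_absorbr idq) => //; apply: act_O.
Qed.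

(** Multiplying both [t] and [u] by the product of all separators, a unit at [q], pushes [t] into
    every conjugate of [q] and keeps the divisibility. *)
Lemma semilocal_uniformizer : exists t u, [/\ O t, O u, ~ q u,
  forall g, g \in G -> q (act g t) &
  forall x, q x -> exists2 y, O y & u * x = t * y].
Proof.
have [t [u [qt Ou nqu Hu]]] := prime_ideal_uniformizer prq.
have /choice[z Hz] g : exists z, g \in G -> [/\ O z, ~ q z & forall y, q y -> q (act g (z * y))].
  case: (boolP (g \in G)) => [/decomposition_separator[z Hz]|_]; first by exists z.
  by exists 0.
have Ot := idealO idq qt.
pose X := \prod_(g in G) z g.
have OX : O X by apply: inO_prod => g /Hz[].
exists (X * t), (X * u); split.
- exact: inOM.
- exact: inOM.
- by apply: (prime_ideal_notM prq) => //; apply: (prime_ideal_prod prq) => g /Hz[].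
- move=> g Gg; rewrite /X (bigD1 g) //= -mulrA; case: (Hz g Gg) => _ _; apply.
  by apply: (ideal_absorbl idq) => //; apply: inO_prod => h /andP[/Hz[]].
- by move=> x /Hu[y Oy e]; exists y => //; rewrite -!mulrA e.
Qed.

(* Each factor splits the sum in two by linearity; in the end only traces remain. *)
Lemma twisted_trace_in (J : eqType) (r : seq J) (c x : J -> L0) w :
  (forall j, j \in r -> O (c j) /\ O (x j)) ->
  O w -> (forall g, g \in G -> q (act g w)) ->
  ideal_gen L p (\sum_(g in G) act g w * \prod_(j <- r) (c j - act g (x j))).
Proof.
have idB := extension_ideal sFL prp.
elim: r w => [|j r IHr] w Hr Ow qw.
  under eq_bigr do rewrite big_nil mulr1.
  apply: ideal_gen_sub; apply: (contraction_over sFL prp prq qp).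
    by apply: trace_in; case: Ow.
  exact: (ideal_sum idq).
have [Oc Ox] := Hr j (mem_head _ _).
have {}Hr i : i \in r -> O (c i) /\ O (x i) by move=> ir; apply: Hr; rewrite inE ir orbT.
have -> : \sum_(g in G) act g w * \prod_(j <- j :: r) (c j - act g (x j)) =
  c j * \sum_(g in G) act g w * \prod_(j <- r) (c j - act g (x j)) -
  \sum_(g in G) act g (w * x j) * \prod_(j <- r) (c j - act g (x j)).
  rewrite mulr_sumr -sumrB; apply: eq_bigr => g Gg; rewrite big_cons.
  by rewrite act_mul //; [ring | case: Ow | case: Ox].
apply: (idealB idB); first by apply: (ideal_absorbl idB) => //; apply: IHr.
apply: IHr => //; first exact: inOM.
move=> g Gg; rewrite act_mul //; [|by case: Ow|by case: Ox].
by apply: (ideal_absorbr idq); [exact: act_O | exact: qw].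
Qed.

Theorem tame_ramification_bound : ~ q #|inertia|%:R ->
  ~ (forall x, ideal_gen L p x -> ideal_exp L q #|inertia|.+1 x).
Proof.
move=> tame pqe.
have [t [u [Ot Ou nqu qt Hu]]] := semilocal_uniformizer.
have [Lt _] := Ot; have [Lu _] := Ou.
have IG := inertia_subset.
have /choice[x Hx] h : exists x, h \in G :\: inertia -> O x /\ ~ q (act h x - x).
  case: (boolP (h \in G :\: inertia)) => [|_]; last by exists 0.
  rewrite inE => /andP[nI Gh]; apply: contrapT => nex; case/negP: nI; apply/inertiaP.
  split=> // x Ox; apply: contrapT => nq; apply: nex; by exists x.
have GI h : h \in G :\: inertia -> h \in G by case/setDP.
pose r := enum (G :\: inertia).
have rP h : h \in r -> h \in G :\: inertia by rewrite mem_enum.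
pose E g := \prod_(h <- r) (act h (x h) - act g (x h)).
have OE g : g \in G -> O (E g).
  move=> Gg; rewrite /E big_seq; apply: inO_prod => h /rP hr.
  by have [Ox _] := Hx h hr; apply: inOB; apply: act_O => //; apply: GI.
(* The norm makes [w] fixed by inertia, so that [w] factors out of the twisted trace, whose terms
   outside inertia vanish. *)
pose w := \prod_(h in inertia) act h t.
have Oat h : h \in inertia -> O (act h t) by move=> /IG Gh; apply: act_O.
have Ow : O w by apply: inO_prod.
have [Lw _] := Ow.
have qw g : g \in G -> q (act g w).
  move=> Gg; rewrite /w act_prod //; last by move=> h /Oat[].
  rewrite (bigD1 1%g) ?group1 //= act_group1 //; apply: (ideal_absorbr idq); last exact: qt.
  by apply: inO_prod => h /andP[/Oat Oh _]; apply: act_O.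
have actw g : g \in inertia -> act g w = w.
  move=> Ig; rewrite /w act_prod ?IG //; last by move=> h /Oat[].
  rewrite [RHS](reindex_inj (mulIg g)) /=.
  apply: eq_big => h; first by rewrite groupMr.
  by move=> Ih; rewrite actM ?IG.
pose c := \sum_(g in inertia) E g.
have Bwc : ideal_gen L p (w * c).
  have -> : w * c = \sum_(g in G) act g w * E g.
    have GII : G :&: inertia = inertia by apply/setIidPr/subsetP => h; apply: IG.
    rewrite /c mulr_sumr [RHS](big_setID inertia) /= GII.
    rewrite [X in _ = _ + X]big1 ?addr0; first by apply: eq_bigr => g Ig; rewrite actw.
    move=> g gI; have gr : g \in r by rewrite mem_enum.
    by rewrite /E (big_rem g) //= subrr mul0r mulr0.
  apply: twisted_trace_in => // h /rP hr; have [Ox _] := Hx h hr.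
  by split=> //; apply: act_O => //; apply: GI.
(* Modulo [q], [c] is [#|inertia|] times [E 1]; tameness enters here. *)
have nqc : ~ q c.
  have nqE : ~ q (E 1%g).
    rewrite /E big_seq; apply: (prime_ideal_prod prq) => h /rP hr.
    have [Ox nqx] := Hx h hr; have [Lx _] := Ox.
    by rewrite act_group1 //; split=> //; apply: inOB => //; apply: act_O => //; apply: GI.
  have qEE g : g \in inertia -> q (E g - E 1%g).
    move=> Ig; rewrite /E !big_seq; apply: prod_congr => h /rP hr.
    have [Ox _] := Hx h hr; have [Lx _] := Ox; have Gh := GI _ hr.
    split; [by apply: inOB; apply: act_O => //; apply: IG|by apply: inOB; apply: act_O|].
    rewrite act_group1 //.
    have -> : act h (x h) - act g (x h) - (act h (x h) - x h) = - (act g (x h) - x h) by ring.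
    by apply: (idealN idq); case/inertiaP: Ig => _; apply.
  move=> qc; apply: (prime_ideal_notM prq (inO_nat L #|inertia|) (OE _ (group1 G)) tame nqE).
  have -> : #|inertia|%:R * E 1%g = c - \sum_(g in inertia) (E g - E 1%g).
    by rewrite sumrB /c opprB addrC subrK sumr_const mulr_natl.
  by apply: (idealB idq) => //; apply: (ideal_sum idq) => g /qEE.
(* Since the inverse of [h] sends [t] into [q], that image times [u] is a multiple of [t]. Applying
   [h] shows that [act h t] divides [t] up to the unit [act h u]. *)
have /choice[s Hs] h : exists s, h \in inertia -> O s /\ act h u * t = act h t * s.
  case: (boolP (h \in inertia)) => [Ih|_]; last by exists 0.
  have Gh := IG _ Ih.
  have [y Oy e] := Hu _ (qt _ (groupVr Gh)).
  exists (act h y) => _; split; first exact: act_O.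
  move: (congr1 (act h) e); rewrite !act_mul ?act_in ?groupV //; last by case: Oy.
  by rewrite act_Kinv.
pose v := c * \prod_(h in inertia) act h u.
have Oau h : h \in inertia -> O (act h u) by move=> /IG Gh; apply: act_O.
have Oc : O c by apply: inO_sum => g /IG /OE.
have nqv : ~ q v.
  apply: (prime_ideal_notM prq) => //; first by apply: inO_prod.
  apply: (prime_ideal_prod prq) => h Ih; split; first exact: Oau.
  move=> qhu; apply: nqu; rewrite -[u](subKr (act h u)).
  by apply: (idealB idq) => //; case/inertiaP: Ih => _; apply.
have Bt : ideal_gen L p (t ^+ #|inertia| * v).
  have -> : t ^+ #|inertia| * v = w * c * \prod_(h in inertia) s h.
    have e : w * \prod_(h in inertia) s h =
        (\prod_(h in inertia) act h u) * t ^+ #|inertia|.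
      rewrite /w -big_split /= -prodr_const -big_split /=.
      by apply: eq_bigr => h /Hs[].
    by rewrite mulrAC e /v [in RHS]mulrC [in RHS]mulrA [LHS]mulrC.
  apply: (ideal_absorbr (extension_ideal sFL prp)) => //.
  by apply: inO_prod => h /Hs[].
(* If the extension of [p] were in the next power of [q], cancelling [t ^+ #|inertia|] would make a
   product of units at [q] a multiple of [t]. *)
have [y Oy] := ideal_exp_uniformizer prq Ot Ou Hu (pqe _ Bt).
rewrite exprS [t ^+ _.+1]exprS.
have nzt : t ^+ #|inertia| != 0.
  apply: expf_neq0; apply/eqP => t0; apply: (prime_ideal_notM prq Ou Ou nqu nqu).
  have [l [prl ql]] := prime_ideal_nat prq.
  have [y' _ e] := Hu _ ql; move/eqP: e; rewrite t0 mul0r mulf_eq0.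
  rewrite fieldExt_natr_eq0 (negPf (lt0n_neq0 (prime_gt0 prl))) orbF => /eqP ->.
  by rewrite mul0r; apply: (ideal0 idq).
move=> e.
have {}e : u ^+ #|inertia|.+1 * v = t * y.
  by apply: (mulfI nzt); rewrite exprS mulrCA e [RHS]mulrCA mulrA.
have : q (u ^+ #|inertia|.+1 * v).
  by rewrite e; apply: (ideal_absorbr idq) => //; rewrite -(act_group1 Lt); apply: qt.
have Ov : O v by apply: inOM => //; apply: inO_prod.
case/(prime_idealM prq (inOX _ Ou) Ov) => //.
by move/(prime_idealX prq Ou).
Qed.

End GaloisAction.

(** * Automorphisms of a splitting field as permutations of the roots *)

Section SplittingAction.
Variables (F0 : fieldType) (L0 : fieldExtType F0) (F : {subfield L0}) (rs : seq L0).
Hypothesis uniq_rs : uniq rs.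
Let g : {poly L0} := \prod_(r <- rs) ('X - r%:P).
Hypothesis Fg : g \is a polyOver F.
Let L : {subfield L0} := <<F & rs>>%AS.
Implicit Types (x y z : L0) (E : {subfield L0}) (f h : 'End(L0)).

Let sFL : (F <= L)%VS. Proof. exact: subv_adjoin_seq. Qed.
Let rsL r : r \in rs -> r \in L. Proof. exact: seqv_sub_adjoin. Qed.
Let root_g r : root g r = (r \in rs). Proof. exact: root_prod_XsubC. Qed.

Let split_gL E : (F <= E)%VS -> (E <= L)%VS -> splittingFieldFor E g L.
Proof.
by move=> sFE sEL; apply: (splittingFieldForS sFE sEL); exists rs; rewrite ?eqpxx.
Qed.

Lemma kHom_adjoin_seq_in E (r : seq L0) f : kHom F L f -> (<<E & r>> <= L)%VS ->
  (forall x, x \in E -> f x \in L) -> (forall x, x \in r -> f x \in L) ->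
  forall x, x \in <<E & r>>%VS -> f x \in L.
Proof.
move=> homf; elim: r E => [|z r IHr] E sEL fE fr x; first by rewrite Fadjoin_nil; apply: fE.
rewrite adjoin_cons; apply: (IHr <<E; z>>%AS) => [||y yr].
- by rewrite -adjoin_cons.
- have sEz : (<<E; z>> <= L)%VS.
    by apply: subv_trans sEL; rewrite adjoin_cons subv_adjoin_seq.
  have sE : (E <= L)%VS by apply: subv_trans sEz; apply: subv_adjoin.
  move=> _ /Fadjoin_polyP[P EP ->].
  rewrite (kHom_horner homf (polyOverSv sE EP)); last by apply: (subvP sEz); apply: memv_adjoin.
  apply: rpred_horner; last by apply: fr; rewrite inE eqxx.
  by apply/polyOverP => i; rewrite coef_map; apply: fE; apply: (polyOverP EP).
- by apply: fr; rewrite inE yr orbT.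
Qed.

(** Normality of [L]: roots of [g] go to roots of [g], and these generate [L]. *)
Lemma kHom_kAut_splitting E f : (F <= E)%VS -> (E <= L)%VS -> kHom E L f -> kAut E L f.
Proof.
move=> sFE sEL homf; rewrite kAutE homf; apply/subvP => _ /memv_imgP[x Lx ->].
have homF := kHomSl sFE homf.
apply: (kHom_adjoin_seq_in homF (subvv _)) Lx => [y Fy|r rrs].
  by case/kHomP_tmp: homF => -> // _; apply: (subvP sFL).
by apply: rsL; rewrite -root_g; apply: (kHom_root_id sFL homF) => //; rewrite ?rsL ?root_g.
Qed.

Lemma kHom_eq_adjoin_seq E (r : seq L0) f h : kHom F L f -> kHom F L h ->
  (<<E & r>> <= L)%VS -> {in E, f =1 h} -> {in r, f =1 h} ->
  {in <<E & r>>%VS, f =1 h}.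
Proof.
move=> homf homh; elim: r E => [|z r IHr] E sEL fE fr x; first by rewrite Fadjoin_nil; apply: fE.
rewrite adjoin_cons; apply: (IHr <<E; z>>%AS) => [||y yr].
- by rewrite -adjoin_cons.
- have sEz : (<<E; z>> <= L)%VS.
    by apply: subv_trans sEL; rewrite adjoin_cons subv_adjoin_seq.
  have sE : (E <= L)%VS by apply: subv_trans sEz; apply: subv_adjoin.
  have Lz : z \in L by apply: (subvP sEz); apply: memv_adjoin.
  move=> _ /Fadjoin_polyP[P EP ->].
  rewrite (kHom_horner homf (polyOverSv sE EP)) // (kHom_horner homh (polyOverSv sE EP)) //.
  rewrite fr ?inE ?eqxx //; congr _.[_].
  by apply/polyP => i; rewrite !coef_map /= fE //; apply: (polyOverP EP).
- by apply: fr; rewrite inE yr orbT.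
Qed.

(* Artin's argument, one root at a time: [x] is a polynomial in [z] of degree less than
   [minPoly E z], taking the value [x] at all conjugates of [z], hence constant. *)
Lemma kAut_fixed E (r : seq L0) x : (F <= E)%VS -> <<E & r>>%VS = L ->
  {subset r <= rs} -> x \in L -> (forall f, kAut E L f -> f x = x) -> x \in E.
Proof.
elim: r E => [|z r IHr] E sFE; first by rewrite Fadjoin_nil => ->.
rewrite adjoin_cons => EzL sr Lx fixx.
have zrs : z \in rs by apply: sr; rewrite inE eqxx.
have sEEz : (E <= <<E; z>>)%VS := subv_adjoin E z.
have sEzL : (<<E; z>> <= L)%VS by rewrite -EzL; apply: subv_adjoin_seq.
have sEL := subv_trans sEEz sEzL.
have sFEz := subv_trans sFE sEEz.
have Ezx : x \in <<E; z>>%VS.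
  apply: (IHr <<E; z>>%AS) => //; first by move=> y yr; apply: sr; rewrite inE yr orbT.
  by move=> f autf; apply: fixx; apply: kAutS autf.
have Eg : g \is a polyOver E := polyOverSv sFE Fg.
have mg : minPoly E z %| g by rewrite minPoly_dvdp // root_g.
have [b mb] := dvdp_prod_XsubC mg.
set ws := mask b rs in mb.
pose P := Fadjoin_poly E z x.
have EP : P \is a polyOver E := Fadjoin_polyOver E z x.
have xP : P.[z] = x := Fadjoin_poly_eq Ezx.
(* The [E]-embedding sending [z] to its conjugate [w] extends to an automorphism of [L], which fixes
   [x = P.[z]]; hence [P.[w] = x]. *)
have rootsP w : w \in ws -> root (P - x%:P) w.
  move=> wws; have hom1 : kHom E E (\1 : 'End(L0)) := kHom1 E E.
  have id1 (Q : {poly L0}) : map_poly (\1%VF : 'End(L0)) Q = Q.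
    by apply/polyP => i; rewrite coef_map /= lfunE.
  have mw : root (map_poly (\1%VF : 'End(L0)) (minPoly E z)) w.
    by rewrite id1 (eqp_root mb) root_prod_XsubC.
  have homw := kHomExtendP (subvv E) hom1 mw.
  have [f homf fE] := kHom_extends (E := <<E; z>>%AS) sEEz homw Eg (split_gL sFEz sEzL).
  have autf := kHom_kAut_splitting sFE sEL homf.
  rewrite /root hornerD hornerN hornerC subr_eq0; apply/eqP.
  rewrite -[RHS](fixx f autf) -fE // -[in RHS]xP (kHomExtend_poly hom1 mw) //.
  by rewrite id1.
have size_ws : size ws = adjoin_degree E z.
  by apply: succn_inj; rewrite -size_minPoly (eqp_size mb) size_prod_XsubC.
have /eqP P0 : P - x%:P == 0.
  apply: contraT => nzP.
  have := max_poly_roots nzP (introT allP rootsP) (mask_uniq uniq_rs b).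
  rewrite size_ws ltnNge => /negP[]; apply: leq_trans (size_polyD _ _) _.
  rewrite geq_max size_Fadjoin_poly size_polyN; apply: leq_trans (size_polyC_leq1 _) _.
  by rewrite /adjoin_degree.
have -> : x = P`_0 by move/eqP: P0; rewrite subr_eq0 => /eqP ->; rewrite coefC.
exact: (polyOverP EP).
Qed.

Lemma kAut_perm f : kAut F L f -> exists s : 'S_(size rs),
  forall i : 'I_(size rs), f rs`_i = rs`_(s i).
Proof.
move=> autf; have homf := kHom_kAut_sub autf.
have frs (i : 'I_(size rs)) : f rs`_i \in rs.
  rewrite -root_g; apply: (kHom_root_id sFL homf) => //; first by rewrite rsL ?mem_nth.
  by rewrite root_g mem_nth.
pose s (i : 'I_(size rs)) : 'I_(size rs) := Ordinal (etrans (index_mem _ _) (frs i)).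
have sE i : rs`_(s i) = f rs`_i by rewrite nth_index.
have inj_s : injective s.
  move=> i j /(congr1 (fun k : 'I__ => rs`_k)); rewrite !sE => fij.
  have : f (rs`_i - rs`_j) = 0 by rewrite linearB /= fij subrr.
  have [_ fM] := kHomP_tmp homf.
  have [e _|nz f0] := eqVneq (rs`_i) (rs`_j).
    by apply: val_inj; apply/eqP; rewrite -(nth_uniq 0 (ltn_ord i) (ltn_ord j) uniq_rs) e.
  have Lij : rs`_i - rs`_j \in L by rewrite rpredB ?rsL ?mem_nth.
  have f1 : f 1 = 1 by case/kHomP_tmp: homf => H _; rewrite H ?mem1v.
  rewrite -subr_eq0 in nz; have LV : (rs`_i - rs`_j)^-1 \in L by rewrite rpredV.
  have := fM _ _ Lij LV.
  by rewrite divff // f0 mul0r f1 => /eqP; rewrite oner_eq0.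
by exists (perm inj_s) => i; rewrite permE sE.
Qed.

(** The Galois group is encoded by the permutations of root indices that some automorphism realizes.
    [act] chooses a realization; its restriction to [L] is determined by the values at the roots,
    whence multiplicativity on [L]. *)
Lemma splitting_action : exists (G : {group 'S_(size rs)}) (act : 'S_(size rs) -> 'End(L0)),
  [/\ forall s, s \in G -> kAut F L (act s),
      forall s t x, s \in G -> t \in G -> x \in L -> act (s * t)%g x = act t (act s x),
      forall x, x \in L -> (forall s, s \in G -> act s x = x) -> x \in F &
      forall s (i : 'I_(size rs)), s \in G -> act s rs`_i = rs`_(s i)].
Proof.
pose realizes (s : 'S_(size rs)) f :=
  kAut F L f /\ forall i : 'I_(size rs), f rs`_i = rs`_(s i).
pose G := [set s | `[< exists f, realizes s f >]].
have GP s : reflect (exists f, realizes s f) (s \in G) by rewrite inE; apply: asboolP.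
have realizesM s t f h : realizes s f -> realizes t h -> realizes (s * t)%g (h \o f)%VF.
  move=> [autf fs] [auth ht]; split; last by move=> i; rewrite lfunE /= fs ht permM.
  case/andP: autf auth => homf /eqP fL /andP[homh /eqP hL].
  rewrite /kAut limg_comp fL hL eqxx andbT; apply: comp_kHom_img => //.
  by rewrite fL.
have eq_on_rs f h : kAut F L f -> kAut F L h -> {in rs, f =1 h} -> {in L, f =1 h}.
  move=> /kHom_kAut_sub homf /kHom_kAut_sub homh eqrs.
  apply: (kHom_eq_adjoin_seq homf homh (subvv _)) => // x Fx.
  by case/kHomP_tmp: homf => -> // _; case/kHomP_tmp: homh => ->.
have realizes_eq s f h : realizes s f -> realizes s h -> {in L, f =1 h}.
  move=> [autf fs] [auth hs]; apply: eq_on_rs => // r rrs.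
  by have /(nthP 0)[k klt <-] := rrs; rewrite (fs (Ordinal klt)) (hs (Ordinal klt)).
have groupG : group_set G.
  apply/group_setP; split=> [|s t /GP[f fs] /GP[h ht]].
    apply/GP; exists \1%VF; split; last by move=> i; rewrite lfunE perm1.
    by rewrite /kAut kHom1 lim1g eqxx.
  by apply/GP; exists (h \o f)%VF; apply: realizesM.
have /choice[act Hact] s : exists f, s \in G -> realizes s f.
  by case: (boolP (s \in G)) => [/GP[f fs]|_]; [exists f | exists 0].
exists (Group groupG), act; split=> /=.
- by move=> s /Hact[].
- move=> s t x Gs Gt Lx.
  have Gst : (s * t)%g \in G by rewrite (groupM (G := Group groupG)).
  have := realizes_eq _ _ _ (Hact _ Gst) (realizesM _ _ _ _ (Hact _ Gs) (Hact _ Gt)) x Lx.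
  by rewrite lfunE.
- move=> x Lx fixx; apply: (kAut_fixed (subvv F) (erefl _)) => // f autf.
  have [s fs] := kAut_perm autf.
  have Gs : s \in G by apply/GP; exists f.
  by rewrite -[RHS](fixx s Gs); apply: (realizes_eq s) => //; apply: Hact.
- by move=> s i /Hact[].
Qed.

End SplittingAction.

(** * Roots of a trinomial modulo a prime *)

(** The image of a moved point is moved as well, so it stays among [i] and [j]. *)
Lemma perm_moves_two (T : finType) (t : {perm T}) i j :
  (forall k, t k != k -> k = i \/ k = j) -> t = 1%g \/ t = tperm i j.
Proof.
move=> H; have Ht k : t k != k -> t k = i \/ t k = j.
  by move=> tk; apply: H; rewrite (inj_eq perm_inj).
have [ti|ti] := eqVneq (t i) i.
  left; apply/permP => k; rewrite perm1; apply/eqP; apply: contraT => tk.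
  case: (H k tk) => ek; subst k; first by rewrite ti eqxx in tk.
  case: (Ht j tk) => tj; last by rewrite tj eqxx in tk.
  have ji : j = i by apply: (@perm_inj _ t); rewrite tj ti.
  by rewrite ji ti eqxx in tk.
right; have tij : t i = j by case: (Ht i ti) => // e; rewrite e eqxx in ti.
have tj : t j != j by rewrite -{1}tij -[X in _ != X]tij (inj_eq perm_inj).
have tji : t j = i by case: (Ht j tj) => // e; rewrite e eqxx in tj.
apply/permP => k; case: tpermP => [->|->|/eqP ki /eqP kj] //.
by apply/eqP; apply: contraT => /H[] e; rewrite e eqxx in ki kj.
Qed.

Section CongruenceModPrime.
Variables (L0 : fieldExtType rat) (L : {subfield L0}) (q : L0 -> Prop).
Hypothesis prq : is_prime_ideal L q.
Let idq := prime_idealW prq.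
Notation O := (inO L).
Implicit Types x y : L0.

Lemma congrX x y n : O x -> O y -> q (x - y) -> q (x ^+ n - y ^+ n).
Proof.
move=> Ox Oy qxy; rewrite subrXX; apply: (ideal_absorbr idq) => //.
by apply: inO_sum => i _; apply: inOM; apply: inOX.
Qed.

Lemma coprime_nat_not_in m n : coprime m n -> (0 < m)%N -> q m%:R -> ~ q n%:R.
Proof.
move=> cmn m0 qm qn; have [k _ /dvdnP[c e]] := Bezoutl n m0.
apply: (prime_ideal1 prq).
have -> : 1 = c%:R * m%:R - k%:R * n%:R :> L0.
  by rewrite -!natrM -e (eqP cmn) natrD addrK.
by apply: (idealB idq); apply: (ideal_absorbl idq) => //; apply: inO_nat.
Qed.

(** By Bezout [1 + k * n = c * m], so [x] and [y] have congruent powers of the consecutive exponents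
    [k * n] and [1 + k * n]; the unit [x ^+ (k * n)] cancels. *)
Lemma congr_coprime_exponents m n x y : coprime m n -> (0 < m)%N -> O x -> O y ->
  ~ q x -> q (x ^+ m - y ^+ m) -> q (x ^+ n - y ^+ n) -> q (x - y).
Proof.
move=> cmn m0 Ox Oy nqx qm qn; have [k _ /dvdnP[c]] := Bezoutl n m0.
rewrite (eqP cmn) => e.
have qcm : q (x ^+ (1 + k * n) - y ^+ (1 + k * n)).
  by rewrite e mulnC !exprM; apply: congrX => //; apply: inOX.
have qkn : q (x ^+ (k * n) - y ^+ (k * n)).
  by rewrite mulnC !exprM; apply: congrX => //; apply: inOX.
have : q (x ^+ (k * n) * (x - y)).
  have -> : x ^+ (k * n) * (x - y) = x ^+ (1 + k * n) - y ^+ (1 + k * n)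
      - y * (x ^+ (k * n) - y ^+ (k * n)) by rewrite !exprS; ring.
  by apply: (idealB idq) => //; apply: (ideal_absorbl idq).
case/(prime_idealM prq (inOX _ Ox) (inOB Ox Oy)) => //.
by move/(prime_idealX prq Ox).
Qed.

Lemma inO_horner_coef (h : {poly L0}) x : (forall i, O h`_i) -> O x -> O h.[x].
Proof.
move=> Oh Ox; rewrite horner_coef; apply: inO_sum => i _.
by apply: inOM => //; apply: inOX.
Qed.

(** * Multiple roots of a trinomial modulo [q] *)

Variables (d s : nat) (a b : L0).
Hypotheses (ltsd : (s < d)%N) (s0 : (0 < s)%N) (cds : coprime d s).
Hypotheses (Oa : O a) (Ob : O b) (nqa : ~ q a) (nqb : ~ q b).

(* For a root [r] of the trinomial, [r f'(r) = - ((d - s) a r^s + d b)]. *)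
Definition double_root (r : L0) := [/\ O r, r ^+ d + a * r ^+ s + b = 0 &
  q ((d - s)%:R * a * r ^+ s + d%:R * b)].

(** Eliminating [b] instead of [r ^+ d] writes [r f'(r)] as [r ^+ s] times this expression. *)
Lemma double_root_exp r : double_root r -> ~ q r ->
  q (d%:R * r ^+ (d - s) + s%:R * a).
Proof.
move=> [Or r0 qr] nqr.
have : q (r ^+ s * (d%:R * r ^+ (d - s) + s%:R * a)).
  have -> : r ^+ s * (d%:R * r ^+ (d - s) + s%:R * a) =
      d%:R * (r ^+ d + a * r ^+ s + b) - ((d - s)%:R * a * r ^+ s + d%:R * b).
    have -> : r ^+ d = r ^+ (d - s) * r ^+ s by rewrite -exprD subnK // ltnW.
    by rewrite natrB 1?ltnW //; ring.
  by rewrite r0 mulr0 sub0r; apply: (idealN idq).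
case/(prime_idealM prq) => //; first exact: inOX.
  by apply: inOD; apply: inOM => //; [exact: inO_nat | exact: inOX | exact: inO_nat].
by move/(prime_idealX prq Or).
Qed.

(** If [r] were in [q], so would be [b]. The two forms of [r f'(r)] do the rest: [d] in [q] forces
    [s a] in [q], against coprimality, while [s] or [d - s] in [q] forces [d] times a unit in
    [q]. *)
Lemma double_root_units r : double_root r ->
  [/\ ~ q r, ~ q d%:R, ~ q s%:R & ~ q (d - s)%:R].
Proof.
move=> dr; have [Or r0 qr] := dr.
have nqr : ~ q r.
  move=> q_r; apply: nqb.
  have -> : b = - (r ^+ d.-1 * r + a * (r ^+ s.-1 * r)).
    rewrite -!exprSr !prednK // ?(leq_ltn_trans _ ltsd) //.
    by apply/eqP; rewrite -addr_eq0 addrC r0.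
  apply: (idealN idq); apply: (idealD idq); first by apply: (ideal_absorbl idq) => //; apply: inOX.
  by apply: (ideal_absorbl idq) => //; apply: (ideal_absorbl idq) => //; apply: inOX.
have qe := double_root_exp dr nqr.
have nqd : ~ q d%:R.
  move=> qd; have : q (s%:R * a).
    rewrite -[s%:R * a](addKr (d%:R * r ^+ (d - s))); apply: (idealD idq) => //.
    by apply: (idealN idq); apply: (ideal_absorbr idq) => //; apply: inOX.
  case/(prime_idealM prq (inO_nat _ _) Oa) => //.
  by apply: (coprime_nat_not_in cds) => //; apply: leq_ltn_trans ltsd.
split=> //.
- move=> qs; have : q (d%:R * r ^+ (d - s)).
    rewrite -[_ * _](addrK (s%:R * a)); apply: (idealB idq) => //.
    exact: (ideal_absorbr idq).
  by case/(prime_idealM prq (inO_nat _ _) (inOX _ Or)) => // /(prime_idealX prq Or).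
- move=> qds; have : q (d%:R * b).
    rewrite -[d%:R * b](addKr ((d - s)%:R * a * r ^+ s)); apply: (idealD idq) => //.
    apply: (idealN idq); rewrite -mulrA; apply: (ideal_absorbr idq) => //.
    by apply: inOM => //; apply: inOX.
  by case/(prime_idealM prq (inO_nat _ _) Ob).
Qed.

(** If 2 were in [q], the units [d], [s] and [d - s] would all be odd. *)
Lemma double_root_not2 r : double_root r -> ~ q 2%:R.
Proof.
move=> /double_root_units[_ nqd nqs nqds] q2.
have even n : ~ q n%:R -> odd n.
  move=> nqn; apply: contraT => evn; case: nqn.
  rewrite -(odd_double_half n) (negPf evn) add0n -mul2n natrM.
  by apply: (ideal_absorbr idq) => //; apply: inO_nat.
by have := even _ nqds; rewrite oddB 1?ltnW // (even _ nqd) (even _ nqs).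
Qed.

Lemma double_root_unique r r' : double_root r -> double_root r' -> q (r - r').
Proof.
move=> dr dr'; have [Or _ qr] := dr; have [Or' _ qr'] := dr'.
have [nqr nqd nqs nqds] := double_root_units dr.
have [nqr' _ _ _] := double_root_units dr'.
have qe := double_root_exp dr nqr; have qe' := double_root_exp dr' nqr'.
have qds : q (r ^+ (d - s) - r' ^+ (d - s)).
  have : q (d%:R * (r ^+ (d - s) - r' ^+ (d - s))).
    have -> : d%:R * (r ^+ (d - s) - r' ^+ (d - s)) =
      (d%:R * r ^+ (d - s) + s%:R * a) - (d%:R * r' ^+ (d - s) + s%:R * a) by ring.
    exact: (idealB idq).
  by case/(prime_idealM prq (inO_nat _ _) (inOB (inOX _ Or) (inOX _ Or'))).
have qs : q (r ^+ s - r' ^+ s).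
  have : q ((d - s)%:R * a * (r ^+ s - r' ^+ s)).
    have -> : (d - s)%:R * a * (r ^+ s - r' ^+ s) =
      ((d - s)%:R * a * r ^+ s + d%:R * b) - ((d - s)%:R * a * r' ^+ s + d%:R * b) by ring.
    exact: (idealB idq).
  case/(prime_idealM prq (inOM (inO_nat _ _) Oa) (inOB (inOX _ Or) (inOX _ Or'))) => //.
  by move/(prime_ideal_notM prq (inO_nat _ _) Oa nqds nqa).
apply: (congr_coprime_exponents (m := d - s) (n := s)) => //.
- by rewrite /coprime gcdnC -gcdnDr subnK 1?ltnW // gcdnC.
- by rewrite subn_gt0.
Qed.

Variable rs : seq L0.
Hypotheses (uniq_rs : uniq rs) (Ors : forall r, r \in rs -> O r).
Hypothesis rsE : 'X^d + a *: 'X^s + b%:P = \prod_(r <- rs) ('X - r%:P).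

Let root_rs r : r \in rs -> r ^+ d + a * r ^+ s + b = 0.
Proof.
rewrite -root_prod_XsubC -rsE => /rootP.
by rewrite !hornerE.
Qed.

(** Here [h.[r]] is [f'(r)], and [f(r) = 0] turns [r f'(r)] into the left side up to sign. *)
Let root_deriv r h : r \in rs -> 'X^d + a *: 'X^s + b%:P = ('X - r%:P) * h ->
  (d - s)%:R * a * r ^+ s + d%:R * b = - (r * h.[r]).
Proof.
move=> rrs e; have : ('X^d + a *: 'X^s + b%:P)^`().[r] = h.[r].
  by rewrite e derivM derivXsubC mul1r hornerD hornerM hornerXsubC subrr mul0r addr0.
rewrite !derivD derivZ !derivXn derivC addr0 hornerD hornerZ !hornerMn !hornerXn => <-.
rewrite -[r ^+ d.-1 *+ d]mulr_natl -[r ^+ s.-1 *+ s]mulr_natl.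
have -> : b = - (r ^+ d + a * r ^+ s).
  by apply/eqP; rewrite -addr_eq0 addrC root_rs.
rewrite natrB 1?ltnW //.
have d0 : (0 < d)%N by apply: leq_ltn_trans ltsd.
have -> : r ^+ d = r * r ^+ d.-1 by rewrite -exprS prednK.
have -> : r ^+ s = r * r ^+ s.-1 by rewrite -exprS prednK.
by ring.
Qed.

Let coef_prod_O (ts : seq L0) i : {subset ts <= rs} ->
  O (\prod_(r <- ts) ('X - r%:P))`_i.
Proof.
move=> sub; split.
  move: i; apply/polyOverP; rewrite big_seq; apply: rpred_prod => r /sub/Ors[Lr _].
  by rewrite polyOverXsubC.
rewrite big_seq; apply: integral_coef_prod => r /sub/Ors[_ intr] k.
rewrite coefB coefX coefC; apply: integralD; first exact: integral_nat.
by apply: integralN; case: ifP => _ //; exact: (integral_nat _ 0).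
Qed.

(** The derivative at [r] has the factor [r - r']. *)
Lemma congruent_roots_double r r' : r \in rs -> r' \in rs -> r != r' ->
  q (r - r') -> double_root r.
Proof.
move=> rrs r'rs ne qrr'; split; [exact: Ors | exact: root_rs |].
have r'rem : r' \in rem r rs by rewrite mem_rem_uniq // inE eq_sym ne.
pose k := \prod_(t <- rem r' (rem r rs)) ('X - t%:P).
have fE : 'X^d + a *: 'X^s + b%:P = ('X - r%:P) * (('X - r'%:P) * k).
  by rewrite rsE (big_rem r) //= (big_rem r').
rewrite (root_deriv rrs fE) hornerM hornerXsubC; apply: (idealN idq).
apply: (ideal_absorbl idq); first exact: Ors.
apply: (ideal_absorbr idq) => //; apply: inO_horner_coef; last exact: Ors.
by move=> i; apply: coef_prod_O => t /mem_rem/mem_rem.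
Qed.

(* Divide the difference of [(d - s) a x^s + d b] at [r] and [r'] by [r - r']:
   the result is [(d - s) s a r^(s-1)] modulo [q], a unit, but a third root
   congruent to [r] makes it vanish. *)
Lemma no_triple_congruence r r' r'' : r \in rs -> r' \in rs -> r'' \in rs ->
  r != r' -> r != r'' -> r' != r'' -> q (r - r') -> q (r - r'') -> False.
Proof.
move=> rrs r'rs r''rs ne ne2 ne3 qrr' qrr''.
have [nqr nqd nqs nqds] := double_root_units (congruent_roots_double rrs r'rs ne qrr').
have r'rem : r' \in rem r rs by rewrite mem_rem_uniq // inE eq_sym ne.
have r''rem : r'' \in rem r' (rem r rs).
  by rewrite !(mem_rem_uniq, rem_uniq) // !inE eq_sym ne3 mem_rem_uniq // inE eq_sym ne2.
pose k := \prod_(t <- rem r'' (rem r' (rem r rs))) ('X - t%:P).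
have Ok x : x \in rs -> O k.[x].
  move=> xrs; apply: inO_horner_coef; last exact: Ors.
  by move=> i; apply: coef_prod_O => t /mem_rem/mem_rem/mem_rem.
have fE : 'X^d + a *: 'X^s + b%:P = ('X - r%:P) * (('X - r'%:P) * (('X - r''%:P) * k)).
  by rewrite rsE (big_rem r) //= (big_rem r') //= (big_rem r'').
have fE' : 'X^d + a *: 'X^s + b%:P = ('X - r'%:P) * (('X - r%:P) * (('X - r''%:P) * k)).
  by rewrite fE mulrCA.
have e := root_deriv rrs fE; have e' := root_deriv r'rs fE'.
rewrite !(hornerM, hornerXsubC) in e e'.
pose S := \sum_(i < s) r ^+ (s.-1 - i) * r' ^+ i.
have Or := Ors rrs; have Or' := Ors r'rs; have Or'' := Ors r''rs.
have eS : (d - s)%:R * a * S = - (r * ((r - r'') * k.[r]) + r' * ((r' - r'') * k.[r'])).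
  have nz : r - r' != 0 by rewrite subr_eq0.
  apply: (mulfI nz).
  have -> : (r - r') * ((d - s)%:R * a * S) =
     ((d - s)%:R * a * r ^+ s + d%:R * b) - ((d - s)%:R * a * r' ^+ s + d%:R * b).
    by rewrite mulrCA /S -subrXX; ring.
  by rewrite e e'; ring.
have qr'r'' : q (r' - r'').
  have -> : r' - r'' = (r - r'') - (r - r') by ring.
  exact: (idealB idq).
have qS : q ((d - s)%:R * a * S).
  rewrite eS; apply: (idealN idq).
  by apply: (idealD idq); apply: (ideal_absorbl idq) => //; apply: (ideal_absorbr idq) => //; apply: Ok.
have OS : O S by apply: inO_sum => i _; apply: inOM; apply: inOX.
case/(prime_idealM prq (inOM (inO_nat _ _) Oa) OS): qS.
  by move/(prime_ideal_notM prq (inO_nat _ _) Oa nqds nqa).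
move=> qS.
(* Each of the [s] terms of [S] is congruent to [r ^+ s.-1]. *)
have : q (s%:R * r ^+ s.-1).
  have -> : s%:R * r ^+ s.-1 = S + \sum_(i < s) r ^+ (s.-1 - i) * (r ^+ i - r' ^+ i).
    rewrite /S -big_split /= -[s in LHS]card_ord mulr_natl -sumr_const.
    apply: eq_bigr => i _; have le_i : (i <= s.-1)%N by rewrite -ltnS prednK // ltn_ord.
    by rewrite -mulrDr addrCA subrr addr0 -exprD subnK ?card_ord.
  apply: (idealD idq) => //; apply: (ideal_sum idq) => i _.
  by apply: (ideal_absorbl idq); [exact: inOX | apply: congrX].
case/(prime_idealM prq (inO_nat _ _) (inOX _ Or)) => //.
by move/(prime_idealX prq Or).
Qed.

End CongruenceModPrime.

(** A nontrivial gcd with the derivative would be [h] itself, which cannot divide a nonzero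
    polynomial of smaller degree. *)
Lemma irreducible_separable (K : fieldType) (h : {poly K}) :
  irreducible_poly h -> h^`() != 0 -> separable.separable_poly h.
Proof.
move=> [sz_h irr] nz_h'; apply: contraT => nsep.
have /irr/(_ (dvdp_gcdl _ _)) eq_h : size (gcdp h h^`()) != 1%N.
  by move: nsep; rewrite unlock.
have : h %| h^`() by rewrite -(eqp_dvdl _ eq_h) dvdp_gcdr.
move/(dvdp_leq nz_h'); rewrite leqNgt => /negP[]; apply: lt_size_deriv.
by rewrite -size_poly_gt0 ltnW.
Qed.

(** * Ramification in the splitting field of a trinomial *)

Theorem theorem2p1 (L0 : fieldExtType rat) (F : {subfield L0})
    (d s : nat) (A B : subvs_of F) (rs : seq L0) (beta : L0)
    (p : L0 -> Prop) :
  let f : {poly subvs_of F} := 'X^d + A *: 'X^s + B%:P in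
  (d > s)%N -> (s >= 1)%N -> coprime d s ->
  integral (vsval A) -> integral (vsval B) ->
  irreducible_poly f ->
  (* rs is the full list of roots of f in the ambient field L0 *)
  map_poly vsval f = \prod_(r <- rs) ('X - r%:P) ->
  beta \in rs ->
  is_prime_ideal F p -> ~ p (vsval A * vsval B) ->
  let K := <<F; beta>>%VS in
  let L := <<F & rs>>%VS in
  ramifies_in K p ->
  (forall q, is_prime_ideal L q -> lies_over L q p -> ram_index L p q 2) /\
  (exists sigma : 'End(L0), kAut F L sigma /\
     exists r1 r2, [/\ r1 \in rs, r2 \in rs, r1 != r2,
       sigma r1 = r2 /\ sigma r2 = r1 &
       forall r, r \in rs -> r != r1 -> r != r2 -> sigma r = r]).
Proof.
move=> f ltsd s0 cds intA intB irrf fE beta_rs prp npAB K L [Q [e [prQ Qp [pQe _] e1]]].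
set a := vsval A in intA npAB; set b := vsval B in intB npAB.
have idp := prime_idealW prp.
have fE' : 'X^d + a *: 'X^s + b%:P = \prod_(r <- rs) ('X - r%:P).
  by rewrite -fE /f !rmorphD /= linearZ /= !map_polyXn map_polyC.
have Fa : a \in F := subvsP A.
have Fb : b \in F := subvsP B.
have d0 : (0 < d)%N by apply: leq_ltn_trans ltsd.
have uniq_rs : uniq rs.
  rewrite -separable_prod_XsubC -fE separable_map; apply: irreducible_separable => //.
  (* The leading coefficient of the derivative is [d], nonzero in characteristic 0. *)
  apply/eqP => /(congr1 (fun h : {poly subvs_of F} => h`_d.-1)).
  rewrite coef_deriv /f !coefE prednK // eqxx gtn_eqF // (gtn_eqF d0) mulr0 !addr0.
  move/eqP; rewrite -[_ *+ _]/(d%:R) fieldExt_natr_eq0.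
  by rewrite -leqn0 leqNgt d0.
have Fg : \prod_(r <- rs) ('X - r%:P) \is a polyOver F.
  by rewrite -fE; apply/polyOverP => i; rewrite coef_map subvsP.
have [G [act [act_aut actM act_fixed act_rs]]] := splitting_action uniq_rs Fg.
have sFL : (F <= L)%VS := subv_adjoin_seq F rs.
have rsL r : r \in rs -> r \in L by apply: seqv_sub_adjoin.
have sFK : (F <= K)%VS := subv_adjoin F beta.
have sKL : (K <= L)%VS by apply/FadjoinP; split=> //; apply: rsL.
have Ors r : r \in rs -> inO L r.
  move=> rrs; split; first exact: rsL.
  apply: (@integral_root_monic_poly _ (\prod_(r <- rs) ('X - r%:P))).
  - exact: monic_prod_XsubC.
  - by rewrite root_prod_XsubC.
  move=> i; rewrite -fE' !coefE; apply: integralD; first apply: integralD.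
  - exact: integral_nat.
  - by apply: integralM => //; apply: integral_nat.
  - by case: ifP => _ //; exact: (integral_nat _ 0).
(* The transposition is found at any one prime above [p], and such a prime exists. *)
suff main q : is_prime_ideal L q -> lies_over L q p -> ram_index L p q 2 /\
    exists2 t, t \in G & exists i j, i != j /\ t = tperm i j.
  split=> [q prq qp|]; first by case: (main q prq qp).
  have [q [prq qp]] := prime_over_exists sFL prp.
  have [_ [t Gt [i [j [ij tE]]]]] := main q prq qp.
  exists (act t); split; first exact: act_aut.
  exists rs`_i, rs`_j; rewrite !mem_nth // nth_uniq //; split=> //.
    by split; rewrite act_rs // tE ?tpermL ?tpermR.
  move=> _ /(nthP 0)[k klt <-]; rewrite !nth_uniq // => ki kj.
  rewrite (act_rs _ (Ordinal klt)) // tE tpermD //; first by rewrite eq_sym.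
  by rewrite eq_sym.
move=> prq qp; have idq := prime_idealW prq.
have pq2 x : ideal_gen L p x -> ideal_exp L q 2 x.
  move=> px; apply: (ideal_exp_anti idq e1).
  exact: (ramified_above sFL act_aut actM act_fixed prp prq qp sFK sKL prQ Qp pQe).
have Oa : inO L a by apply: (inOS sFL).
have Ob : inO L b by apply: (inOS sFL).
have nqa : ~ q a.
  move=> /(contraction_over sFL prp prq qp Fa) pa.
  by apply: npAB; apply: (ideal_absorbr idp).
have nqb : ~ q b.
  move=> /(contraction_over sFL prp prq qp Fb) pb.
  by apply: npAB; apply: (ideal_absorbl idp).
pose I := inertia <<F & rs>>%AS G act q.
have I1 : 1%g \in I := group1 (inertia_group sFL act_aut actM prq).
have bound := tame_ramification_bound sFL act_aut actM act_fixed prp prq qp.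
have act_root t (k : 'I_(size rs)) : t \in I -> q (rs`_(t k) - rs`_k).
  by case/inertiaP => Gt H; rewrite -act_rs //; apply/H/Ors/mem_nth.
(* A trivial inertia group is tame, and the bound would then contradict [pq2]. *)
have [t It t1] : exists2 t, t \in I & t != 1%g.
  apply: contrapT => nex; have IE : I = [set 1%g].
    apply/setP => t; rewrite in_set1; apply/idP/eqP => [It|->]; last exact: I1.
    by apply/eqP; apply: contraT => t1; case: nex; exists t.
  move: bound; rewrite -/I IE cards1; apply=> //; exact: (prime_ideal1 prq).
have [i ti] : exists i, t i != i.
  apply: contrapT => nex; case/eqP: t1; apply/permP => i; rewrite perm1.
  by apply/eqP; apply: contraT => ti; case: nex; exists i.
set j := t i in ti.
have nth_neq (k l : 'I_(size rs)) : k != l -> rs`_k != rs`_l by rewrite nth_uniq.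
have double u k : u \in I -> u k != k -> double_root L q d s a b rs`_k.
  move=> Iu uk; apply: (congruent_roots_double prq ltsd s0 uniq_rs Ors fE' (r' := rs`_(u k))).
  - exact: mem_nth.
  - exact: mem_nth.
  - by apply: nth_neq; rewrite eq_sym.
  - by rewrite -opprB; apply: (idealN idq); apply: act_root.
(* A moved root is congruent to its image, hence double. If a third index [k] were moved, its root
   would be congruent to those of [i] and [j], a triple congruence. *)
have inI u : u \in I -> u = 1%g \/ u = tperm i j.
  move=> Iu; apply: perm_moves_two => k uk.
  apply: contrapT => /not_orP[/eqP ki /eqP kj].
  have qik : q (rs`_i - rs`_k).
    exact: (double_root_unique prq ltsd s0 cds Oa Ob nqa nqb (double t i It ti) (double u k Iu uk)).
  apply: (no_triple_congruence prq ltsd s0 cds Oa Ob nqa nqb uniq_rs Ors fE' (r := rs`_i)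
           (r' := rs`_j) (r'' := rs`_k)); rewrite ?mem_nth ?nth_neq //.
  - by rewrite eq_sym.
  - by rewrite eq_sym.
  - by rewrite eq_sym.
  - by rewrite -opprB; apply: (idealN idq); apply: act_root.
have tE : t = tperm i j by case: (inI t It) => // e1'; rewrite e1' eqxx in t1.
have cardI : #|I| = 2%N.
  have -> : I = [set 1%g; t].
    apply/setP => u; rewrite in_set2; apply/idP/orP => [/inI[->|->]|[/eqP ->|/eqP ->]] //.
    - by left.
    - by right; rewrite tE.
  by rewrite cards2 eq_sym t1.
split; last first.
  exists t; first by case/inertiaP: It.
  by exists i, j; rewrite eq_sym.
(* The tame bound for an inertia group of order 2 excludes the third power of [q], as 2 is not in
   [q]. *)
split=> //; move: bound; rewrite -/I cardI; apply.
exact: (double_root_not2 prq ltsd s0 cds Oa Ob nqa nqb (double t i It ti)).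
Qed.
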